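(* Let $m,n\ge 1$ and let $\{(p_i,\theta_i,\gamma_i)\}_{i=1}^m\subset\mathbb{R}^n\times\mathbb{R}\times\mathbb{R}$ satisfy assumptions (A1), (A2), (A3) stated in the context. Let $f:\mathbb{R}^n\times[0,+\infty)\to\mathbb{R}$ be $$f(x,t)=\max_{i\in\{1,\dots,m\}}\{\langle p_i,x\rangle-t\theta_i-\gamma_i\},$$ let $J$ and $H$ be the functions defined in the context, and let $\tilde H:\mathbb{R}^n\to\mathbb{R}$ be a continuous function. Then the following two statements hold. (i) The function $f$ is the unique uniformly continuous viscosity solution to the first-order Hamilton--Jacobi equation $$\begin{cases}\dfrac{\partial f}{\partial t}(x,t)+H(\nabla_x f(x,t))=0 & \text{in }\mathbb{R}^n\times(0,+\infty),\\ f(x,0)=J(x) & \text{in }\mathbb{R}^n.\end{cases}$$ Moreover, $f$ is jointly convex in $(x,t)$. (ii) The function $f$ is the unique uniformly continuous viscosity solution to the first-order Hamilton--Jacobi equation $$\begin{cases}\dfrac{\partial f}{\partial t}(x,t)+\tilde H(\nabla_x f(x,t))=0 & \text{in }\mathbb{R}^n\times(0,+\infty),\\ f(x,0)=J(x) & \text{in }\mathbb{R}^n,\end{cases}$$ if and only if $\tilde H(p_i)=H(p_i)$ for each $i\in\{1,\dots,m\}$ and $\tilde H(p)\ge H(p)$ for every $p\in\operatorname{dom}J^*$.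
   Context: Notation: $\langle\cdot,\cdot\rangle$ is the Euclidean scalar product. The unit simplex is $\Lambda_m=\{(\alpha_1,\dots,\alpha_m)\in[0,1]^m:\sum_{i=1}^m\alpha_i=1\}$. For $\varphi:\mathbb{R}^n\to\mathbb{R}\cup\{+\infty\}$, $\operatorname{dom}\varphi=\{x:\varphi(x)<+\infty\}$, and the Fenchel--Legendre transform is $\varphi^*(p)=\sup_{x\in\mathbb{R}^n}\{\langle p,x\rangle-\varphi(x)\}$. Assumptions on the parameters: (A1) $p_i\ne p_j$ whenever $i\ne j$. (A2) There exists a convex function $g:\mathbb{R}^n\to\mathbb{R}$ such that $g(p_i)=\gamma_i$ for every $i$. (A3) For any $j\in\{1,\dots,m\}$ and any $(\alpha_1,\dots,\alpha_m)\in\Lambda_m$ with $\alpha_j=0$, $\sum_{i\ne j}\alpha_ip_i=p_j$ and $\sum_{i\ne j}\alpha_i\gamma_i=\gamma_j$, there holds $\sum_{i\ne j}\alpha_i\theta_i>\theta_j$. Definition of $J$: $J(x)=\max_{i\in\{1,\dots,m\}}\{\langle p_i,x\rangle-\gamma_i\}$ for $x\in\mathbb{R}^n$. One has $\operatorname{dom}J^*=\operatorname{conv}\{p_1,\dots,p_m\}$. Definition of $\mathcal{A}(p)$ and $H$: for $p\in\operatorname{dom}J^*$, $\mathcal{A}(p)$ is the set of minimizers of $\sum_{i=1}^m\alpha_i\gamma_i$ over all $(\alpha_1,\dots,\alpha_m)\in\Lambda_m$ with $\sum_{i=1}^m\alpha_ip_i=p$. The function $H:\mathbb{R}^n\to\mathbb{R}\cup\{+\infty\}$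 is $$H(p)=\begin{cases}\inf_{\alpha\in\mathcal{A}(p)}\sum_{i=1}^m\alpha_i\theta_i & \text{if }p\in\operatorname{dom}J^*,\\ +\infty&\text{otherwise.}\end{cases}$$ Viscosity solutions are in the standard Crandall--Lions sense: a continuous $v$ on $\mathbb{R}^n\times[0,+\infty)$ with $v(\cdot,0)=J$ is a viscosity solution of $\partial_t v+H(\nabla_xv)=0$ if for every $C^1$ function $\varphi$ and every $(x_0,t_0)\in\mathbb{R}^n\times(0,+\infty)$: if $v-\varphi$ has a local maximum at $(x_0,t_0)$ then $\partial_t\varphi(x_0,t_0)+H(\nabla_x\varphi(x_0,t_0))\le 0$, and if $v-\varphi$ has a local minimum at $(x_0,t_0)$ then $\partial_t\varphi(x_0,t_0)+H(\nabla_x\varphi(x_0,t_0))\ge0$ (the inequalities being read in $\mathbb{R}\cup\{+\infty\}$ when $H$ takes the value $+\infty$). Same definition with $\tilde H$ in place of $H$. ''Unique uniformly continuous viscosity solution'' means unique in the class of viscosity solutions that are uniformly continuous on $\mathbb{R}^n\times[0,+\infty)$. *)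

(* Defs.v *)
From HB Require Import structures.
From mathcomp Require Import all_boot all_order all_algebra.
From mathcomp Require Import all_classical all_reals all_analysis.

Set Implicit Arguments.
Unset Strict Implicit.
Unset Printing Implicit Defensive.

Import Order.TTheory GRing.Theory Num.Theory.
Import numFieldNormedType.Exports.

Local Open Scope classical_set_scope.
Local Open Scope ring_scope.

Section Euclidean.
Context {R : realType}.

Definition dot (n : nat) (u v : 'rV[R]_n) : R := \sum_(i < n) u 0 i * v 0 i.

Definition simplex (m : nat) : set 'rV[R]_m :=
  [set alpha | (forall i, 0 <= alpha 0 i <= 1) /\ \sum_(i < m) alpha 0 i = 1].

Definition edom (T : Type) (phi : T -> \bar R) : set T :=
  [set x | (phi x < +oo)%E].

Definition fenchel (n : nat) (phi : 'rV[R]_n -> \bar R) (p : 'rV[R]_n) : \bar R :=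
  ereal_sup (range (fun x => ((dot p x)%:E - phi x)%E)).

(* The seed [F ord0] is one of the values, so it does not affect the maximum. *)
Definition max_ord (m : nat) (F : 'I_m.+1 -> R) : R :=
  \big[Num.max/F ord0]_(i < m.+1) F i.

End Euclidean.

(* Space-time points are pairs [z = (x, t)].  Functions on R^n x [0, +oo) are
   represented by functions on ['rV_n * R] whose values at negative times are
   irrelevant. *)
Section Viscosity.
Context {R : realType} {n : nat}.
Implicit Types (phi v : 'rV[R]_n * R -> R) (z : 'rV[R]_n * R).

Definition closed_halfspace : set ('rV[R]_n * R) := [set z | 0 <= z.2].
Definition open_halfspace : set ('rV[R]_n * R) := [set z | 0 < z.2].

Definition dt phi z : R := 'D_(0, 1) phi z.
Definition grad_x phi z : 'rV[R]_n := \row_(i < n) 'D_(delta_mx 0 i, 0) phi z.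

Definition C1 phi : Prop :=
  forall z, open_halfspace z ->
    differentiable phi z /\
    forall w : 'rV[R]_n * R, {for z, continuous (fun z' => 'D_w phi z')}.

Definition local_max (g : 'rV[R]_n * R -> R) z0 : Prop :=
  \forall z \near z0, g z <= g z0.
Definition local_min (g : 'rV[R]_n * R -> R) z0 : Prop :=
  \forall z \near z0, g z0 <= g z.

Definition viscosity_subsolution (H : 'rV[R]_n -> \bar R) v : Prop :=
  forall phi, C1 phi -> forall z0, open_halfspace z0 ->
    local_max (fun z => v z - phi z) z0 ->
    ((dt phi z0)%:E + H (grad_x phi z0) <= 0)%E.

Definition viscosity_supersolution (H : 'rV[R]_n -> \bar R) v : Prop :=
  forall phi, C1 phi -> forall z0, open_halfspace z0 ->
    local_min (fun z => v z - phi z) z0 ->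
    (0 <= (dt phi z0)%:E + H (grad_x phi z0))%E.

Definition viscosity_solution (H : 'rV[R]_n -> \bar R) (J : 'rV[R]_n -> R) v
    : Prop :=
  [/\ {within closed_halfspace, continuous v},
      forall x, v (x, 0) = J x,
      viscosity_subsolution H v &
      viscosity_supersolution H v].

Definition uniformly_continuous_on (A : set ('rV[R]_n * R)) v : Prop :=
  forall e : R, 0 < e -> exists2 d : R, 0 < d &
    forall z z', A z -> A z' -> `|z - z'| < d -> `|v z - v z'| < e.

Definition unique_UC_viscosity_solution
    (H : 'rV[R]_n -> \bar R) (J : 'rV[R]_n -> R) v : Prop :=
  [/\ viscosity_solution H J v,
      uniformly_continuous_on closed_halfspace v &
      forall w, viscosity_solution H J w ->
        uniformly_continuous_on closed_halfspace w ->
        {in closed_halfspace, w =1 v}].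

End Viscosity.

Section HJData.
Context {R : realType} {m n : nat}.
Variables (p : 'I_m.+1 -> 'rV[R]_n) (theta gamma : 'I_m.+1 -> R).

Definition assumptionA1 : Prop := forall i j, i != j -> p i != p j.

Definition assumptionA2 : Prop :=
  exists2 g : 'rV[R]_n -> R,
    convex_function [set: 'rV[R]_n] g & forall i, g (p i) = gamma i.

Definition assumptionA3 : Prop :=
  forall (j : 'I_m.+1) (alpha : 'rV[R]_m.+1),
    simplex alpha -> alpha 0 j = 0 ->
    \sum_(i | i != j) alpha 0 i *: p i = p j ->
    \sum_(i | i != j) alpha 0 i * gamma i = gamma j ->
    \sum_(i | i != j) alpha 0 i * theta i > theta j.

Definition f (z : 'rV[R]_n * R) : R :=
  max_ord (fun i => dot (p i) z.1 - z.2 * theta i - gamma i).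

Definition J (x : 'rV[R]_n) : R := max_ord (fun i => dot (p i) x - gamma i).

Definition domJstar : set 'rV[R]_n := edom (fenchel (EFin \o J)).

Definition feasible (q : 'rV[R]_n) : set 'rV[R]_m.+1 :=
  [set alpha | simplex alpha /\ \sum_i alpha 0 i *: p i = q].

Definition minimizers (q : 'rV[R]_n) : set 'rV[R]_m.+1 :=
  [set alpha | feasible q alpha /\
    forall beta, feasible q beta ->
      \sum_i alpha 0 i * gamma i <= \sum_i beta 0 i * gamma i].

Definition H (q : 'rV[R]_n) : \bar R :=
  if q \in domJstar then
    ereal_inf [set (\sum_i alpha 0 i * theta i)%:E | alpha in minimizers q]
  else +oo%E.

End HJData.

(* Main.v *)
Require Import Defs.
From HB Require Import structures.
From mathcomp Require Import all_boot all_order all_algebra.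
From mathcomp Require Import all_classical all_reals all_analysis.
From mathcomp Require Import ring lra.
Import Order.TTheory GRing.Theory Num.Theory.
Import numFieldNormedType.Exports.
Local Open Scope classical_set_scope.
Local Open Scope ring_scope.
Set Implicit Arguments.
Unset Strict Implicit.
Unset Printing Implicit Defensive.

(* Write [l_i (x, t) = <p_i, x> - t theta_i - gamma_i], so that [f] is the maximum
   of the [l_i].  By linear programming duality, a gradient of a function touching
   [f] from below at [(x, t)] is [(bary alpha, - sum alpha_i theta_i)] with [alpha]
   carried by the neurons active at [(x, t)], and then
   [sum alpha_i theta_i <= H (bary alpha)]; a gradient touching from above is some
   [(p_i, - theta_i)], and [H (p_i) = theta_i].  Hence [f] is a solution.

   Uniqueness needs no doubling of variables, since [f] has smooth barriers.
   A subsolution [w] is compared with [eps * ln (sum exp (l_i / eps))] plus a small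
   penalty: the gradient of this function is given by almost active weights, so it
   is almost a supersolution.  A supersolution [w] is compared with each affine
   [l_i].  For [H], which is [+oo] off the convex hull of the [p_i], the penalty is
   not allowed to push the gradient out of the hull: [p_i] is moved to a relative
   interior point [q] of the hull, where [w - <q, x>] is coercive modulo the
   directions [h] on which all the [p_i] agree, and [w] is affine along these
   directions because it is a subsolution.

   Conversely, for [q] in the hull a lexicographic minimizer (for [gamma], then
   [theta]) is supported by the neurons active at some point with [t > 0], where
   the affine function of gradient [(q, - H q)] touches [f] from below; and each
   neuron is strictly active at some point with [t > 0]. *)

(** * Farkas' lemma *)

Section Farkas.
Context {R : realType} {V : lmodType R}.
Implicit Types (a b : V -> R).

Definition functional b := forall (c : R) (x y : V), b (c *: x + y) = c * b x + b y.

Lemma functionalZ b c x : functional b -> b (c *: x) = c * b x.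
Proof.
move=> lb; have b0 : b 0 = 0.
  by have := lb 1 0 0; rewrite scale1r addr0 mul1r => /esym/(canRL (addrK _)); rewrite subrr.
by rewrite -[c *: x]addr0 lb b0 addr0.
Qed.

Lemma functionalD b x y : functional b -> b (x + y) = b x + b y.
Proof. by move=> lb; rewrite -[x]scale1r lb mul1r scale1r. Qed.

Lemma functional_sum b (I : finType) (F : I -> V) :
  functional b -> b (\sum_i F i) = \sum_i b (F i).
Proof.
move=> lb; apply: (big_morph b) => [x y|]; first exact: functionalD.
by rewrite -(scale0r (0 : V)) functionalZ// mul0r.
Qed.

(* Bartl's algebraic induction on the number of constraints: a point where
   the constraint [a k] alone obstructs is used to project along. *)
Lemma farkas_seq (I : eqType) (r : seq I) (a : I -> V -> R) b :
  uniq r -> (forall i, functional (a i)) -> functional b ->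
  (forall x, (forall i, i \in r -> a i x <= 0) -> b x <= 0) ->
  exists2 lam : I -> R, forall i, 0 <= lam i &
    forall x, b x = \sum_(i <- r) lam i * a i x.
Proof.
elim: r a b => [|k r IH] a b.
  move=> _ la lb h; exists (fun=> 0) => // x; rewrite big_nil.
  apply/eqP; rewrite eq_le h//= -oppr_le0 -mulN1r -functionalZ//.
  by rewrite h.
rewrite cons_uniq => /andP[kr ur] la lb h.
(* If the constraint [a k] is redundant it gets multiplier zero. Otherwise [x0] violates it alone:
   [b x0 > 0] although the other constraints hold there. *)
have [hall|] := pselect (forall x, (forall i, i \in r -> a i x <= 0) -> b x <= 0).
  have [lam l0 le] := IH a b ur la lb hall.
  exists (fun i => if i == k then 0 else lam i) => [i|x]; first by case: ifP.
  rewrite big_cons eqxx mul0r add0r le; apply: eq_big_seq => i ir.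
  by case: eqP => // ik; rewrite -ik ir in kr.
move=> /existsNP[x0 /not_implyP[ax0 /negP]]; rewrite -ltNge => bx0.
have akx0 : 0 < a k x0.
  rewrite ltNge; apply/negP => akx0.
  have /h : forall i, i \in k :: r -> a i x0 <= 0.
    by move=> i; rewrite in_cons => /orP[/eqP -> //|/ax0].
  by rewrite leNgt bx0.
pose c i := a i x0 / a k x0.
have [|d|x hx|lam l0 le] :=
    IH (fun i x => a i x - c i * a k x) (fun x => b x - b x0 / a k x0 * a k x) ur.
- by move=> i d x y; rewrite !la; ring.
- by move=> x y; rewrite lb la; ring.
(* [y] is the projection of [x] along [x0] onto the kernel of [a k]; the modified functionals are
   the original ones evaluated at [y]. *)
- pose y := (- (a k x / a k x0)) *: x0 + x.
  have -> : b x - b x0 / a k x0 * a k x = b y by rewrite lb; ring.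
  apply: h => i; rewrite in_cons => /orP[/eqP ->|ir].
    by rewrite la mulNr divfK ?gt_eqF// addNr.
  by rewrite la; have := hx i ir; rewrite /c; lra.
(* The multiplier of [a k] collects the correction terms; it is nonnegative because [b x0 > 0] and
   [a j x0 <= 0] for the other constraints. *)
exists (fun i => if i == k then b x0 / a k x0 - \sum_(j <- r) lam j * c j else lam i).
  move=> i; case: ifP => // _; rewrite subr_ge0.
  apply: (@le_trans _ _ 0); last by rewrite divr_ge0// ltW.
  rewrite big_seq sumr_le0// => j jr.
  by rewrite mulr_ge0_le0// /c mulr_le0_ge0 ?ax0// invr_ge0 ltW.
move=> x; rewrite big_cons eqxx.
rewrite [X in _ + X](eq_big_seq (fun i => lam i * a i x)); last first.
  by move=> i ir /=; case: (i =P k) => // ik; rewrite -ik ir in kr.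
have := le x; rewrite (eq_bigr (fun i => lam i * a i x - lam i * c i * a k x)); last first.
  by move=> i _; ring.
rewrite sumrB -mulr_suml => /(canRL (subrK _)) ->; ring.
Qed.

Lemma farkas (I : finType) (a : I -> V -> R) b :
  (forall i, functional (a i)) -> functional b ->
  (forall x, (forall i, a i x <= 0) -> b x <= 0) ->
  exists2 lam : I -> R, forall i, 0 <= lam i &
    forall x, b x = \sum_i lam i * a i x.
Proof.
move=> la lb h; have [x hx|lam l0 le] := farkas_seq (enum_uniq I) la lb.
  by apply: h => i; apply: hx; rewrite mem_enum.
by exists lam => // x; rewrite le big_enum.
Qed.

(* Summing, over the strict constraints [i], a feasible point with [a i x < 0]
   turns Farkas' lemma into Motzkin's transposition theorem. *)
Lemma motzkin (I : finType) (P : pred I) (a : I -> V -> R) :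
  (forall i, functional (a i)) ->
  (exists2 x, forall i, a i x <= 0 & forall i, P i -> a i x < 0) \/
  (exists lam : I -> R, [/\ forall i, 0 <= lam i,
     forall x, \sum_i lam i * a i x = 0 & exists2 i, P i & 0 < lam i]).
Proof.
move=> la.
have [hs|] := pselect (forall i, exists x, (forall j, a j x <= 0) /\ (P i -> a i x < 0)).
  have /choice[X hX] := hs; left; exists (\sum_i X i) => i.
    by rewrite functional_sum// sumr_le0// => j _; case: (hX j).
  move=> Pi; rewrite functional_sum// (bigD1 i)//=.
  rewrite -[ltRHS]addr0 ltr_leD//; first by case: (hX i) => _; apply.
  by rewrite sumr_le0// => j _; case: (hX j).
move=> /existsNP[i /forallNP hi]; right.
have Pi : P i by apply/negP => /negP nP; apply: (hi 0); split=> [j|/(negP nP)//];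
  rewrite -(scale0r (0 : V)) functionalZ// mul0r.
have lai : functional (fun x => - a i x) by move=> c x y; rewrite la; ring.
have [x hx|lam l0 le] := farkas la lai.
  rewrite leNgt; apply/negP; rewrite oppr_gt0 => ax; exact: (hi x).
(* Farkas' lemma represents [- a i]; raising the multiplier of [a i] by one makes the combination
   vanish with a positive weight at [i]. *)
exists (fun j => lam j + (j == i)%:R); split=> [j|x|].
- by rewrite addr_ge0.
- under eq_bigr do rewrite mulrDl; rewrite big_split/= -le (bigD1 i)//= eqxx mul1r.
  rewrite big1 ?addr0 ?addNr// => j /negbTE ->; rewrite mul0r//.
- by exists i => //; rewrite eqxx ltr_wpDl.
Qed.

End Farkas.

(** * Euclidean space, finite maxima and weights *)

Lemma near_right0_ex (R : realType) (P : R -> Prop) :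
  (\forall e \near 0^'+, P e) -> exists2 e : R, 0 < e & P e.
Proof.
move=> hP; have /filter_ex[e [? ?]] : \forall e \near (0:R)^'+, 0 < e /\ P e.
  by near=> e; split; near: e; [exact: nbhs_right_gt|exact: hP].
by exists e.
Unshelve. all: by end_near. Qed.

Section Dot.
Context {R : realType} {n : nat}.
Implicit Types (u v w : 'rV[R]_n) (c : R).

Lemma dotC u v : dot u v = dot v u.
Proof. by apply: eq_bigr => i _; rewrite mulrC. Qed.

Lemma dotDr u v w : dot u (v + w) = dot u v + dot u w.
Proof. by rewrite -big_split; apply: eq_bigr => i _; rewrite mxE mulrDr. Qed.

Lemma dotZr c u v : dot u (c *: v) = c * dot u v.
Proof. by rewrite mulr_sumr; apply: eq_bigr => i _; rewrite mxE mulrCA. Qed.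

Lemma dotDl u v w : dot (u + v) w = dot u w + dot v w.
Proof. by rewrite !(dotC _ w) dotDr. Qed.

Lemma dotZl c u v : dot (c *: u) v = c * dot u v.
Proof. by rewrite !(dotC _ v) dotZr. Qed.

Lemma dotNr u v : dot u (- v) = - dot u v.
Proof. by rewrite -scaleN1r dotZr mulN1r. Qed.

Lemma dotNl u v : dot (- u) v = - dot u v.
Proof. by rewrite !(dotC _ v) dotNr. Qed.

Lemma dotBr u v w : dot u (v - w) = dot u v - dot u w.
Proof. by rewrite dotDr dotNr. Qed.

Lemma dotBl u v w : dot (u - v) w = dot u w - dot v w.
Proof. by rewrite dotDl dotNl. Qed.

Lemma dot0r u : dot u 0 = 0.
Proof. by rewrite -(scale0r 0) dotZr mul0r. Qed.

Lemma dot0l u : dot 0 u = 0.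
Proof. by rewrite dotC dot0r. Qed.

Lemma dot_suml (I : finType) (F : I -> 'rV[R]_n) u :
  dot (\sum_i F i) u = \sum_i dot (F i) u.
Proof.
by apply: (@big_morph _ _ (fun v => dot v u)) => [x y|]; rewrite ?dotDl ?dot0l.
Qed.

Lemma dot_delta u i : dot u (delta_mx 0 i) = u 0 i.
Proof.
rewrite /dot (bigD1 i)//= mxE !eqxx mulr1 big1 ?addr0// => j /negbTE ji.
by rewrite mxE ji andbF mulr0.
Qed.

Lemma dot_inj u v : (forall w, dot u w = dot v w) -> u = v.
Proof. by move=> h; apply/rowP => i; rewrite -!dot_delta h. Qed.

Lemma dotxx_ge0 u : 0 <= dot u u.
Proof. by apply: sumr_ge0 => i _; rewrite -expr2 sqr_ge0. Qed.

Lemma norm_coord_le u i : `|u 0 i| <= `|u|.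
Proof.
rewrite [leRHS]/Num.norm/= mx_normrE.
by apply: (@le_bigmax _ _ _ 0 (fun ij => `|u ij.1 ij.2|) (0, i)).
Qed.

Lemma norm_le_coord u c : 0 <= c -> (forall i, `|u 0 i| <= c) -> `|u| <= c.
Proof.
move=> c0 uc; rewrite [leLHS]/Num.norm/= mx_normrE.
by apply/bigmax_leP; split=> // -[i j] _; rewrite (ord1 i)/=.
Qed.

(** The norm of row vectors is the maximum norm, hence dominated by the Euclidean one. *)
Lemma norm_le_dot u c : 0 <= c -> dot u u <= c ^+ 2 -> `|u| <= c.
Proof.
move=> c0 uc; apply: norm_le_coord => // i.
rewrite -(@ler_pXn2r _ 2)// ?nnegrE// real_normK ?num_real//.
apply: le_trans uc; rewrite /dot (bigD1 i)//= -expr2 lerDl sumr_ge0// => j _.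
by rewrite -expr2 sqr_ge0.
Qed.

Lemma sqr_norm_le_dot u : `|u| ^+ 2 <= dot u u.
Proof.
rewrite -(sqr_sqrtr (dotxx_ge0 u)) ler_pXn2r ?nnegrE ?sqrtr_ge0//.
by apply: norm_le_dot; rewrite ?sqrtr_ge0// sqr_sqrtr// dotxx_ge0.
Qed.

Lemma norm_dot_le u v : `|dot u v| <= n%:R * `|u| * `|v|.
Proof.
rewrite (le_trans (ler_norm_sum _ _ _))//.
rewrite -mulrA -[n in n%:R]card_ord mulr_natl -sumr_const ler_sum// => i _.
by rewrite normrM ler_pM// norm_coord_le.
Qed.

Lemma dotxx_eq0 u : dot u u = 0 -> u = 0.
Proof.
move=> u0; apply/eqP; rewrite -normr_le0; apply: norm_le_dot => //.
by rewrite u0 expr0n.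
Qed.

End Dot.

Lemma norm_le_bounded_set (R : realType) n (A : set 'rV[R]_n) (c : R) :
  (forall x, A x -> `|x| <= c) -> bounded_set A.
Proof.
move=> Ac; exists c; split; first exact: num_real.
by move=> d cd x Ax /=; rewrite (le_trans (Ac _ Ax))// ltW.
Qed.

Lemma continuous_sum (R : realType) (T : topologicalType) (I : finType)
    (F : I -> T -> R) :
  (forall i, continuous (F i)) -> continuous (fun x => \sum_i F i x).
Proof.
move=> cF; rewrite (_ : (fun x => _) = \sum_i F i); last first.
  by apply/funext => x; rewrite fct_sumE.
apply: (big_ind (fun f : T -> R => continuous f)) => [x|f g cf cg x|i _].
- exact: cvg_cst.
- exact: cvgD (cf x) (cg x).
- exact: cF.
Qed.

Section Max.
Context {R : realType} {m : nat}.
Implicit Types F : 'I_m.+1 -> R.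

Lemma le_max_ord F i : F i <= max_ord F.
Proof. exact: le_bigmax. Qed.

Lemma max_ordP F : exists i, max_ord F = F i.
Proof.
rewrite /max_ord; elim/big_ind: _ => [|x y [i ->] [j ->]|i _]; first by exists ord0.
  by rewrite maxEle; case: ifP => _; [exists j|exists i].
by exists i.
Qed.

Lemma max_ord_le F c : (max_ord F <= c) <-> (forall i, F i <= c).
Proof.
split=> [h i|h]; first exact: le_trans (le_max_ord F i) h.
by have [i ->] := max_ordP F.
Qed.

End Max.

(** * Weights on the simplex, their barycentres and costs *)

Section Polyhedral.
Context {R : realType} {m n : nat}.
Variables (p : 'I_m.+1 -> 'rV[R]_n).
Implicit Types (theta gamma w : 'I_m.+1 -> R) (alpha beta nu : 'rV[R]_m.+1).

(** Used with [w] equal to [gamma], to [theta], to the values of the neurons at a point, or to the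
    constant 1, which gives the total mass. *)
Definition cost w alpha : R := \sum_i alpha 0 i * w i.
Definition bary alpha : 'rV[R]_n := \sum_i alpha 0 i *: p i.

Lemma costD w alpha beta : cost w (alpha + beta) = cost w alpha + cost w beta.
Proof. by rewrite -big_split; apply: eq_bigr => i _; rewrite mxE mulrDl. Qed.

Lemma costZ w c alpha : cost w (c *: alpha) = c * cost w alpha.
Proof. by rewrite mulr_sumr; apply: eq_bigr => i _; rewrite mxE mulrA. Qed.

Lemma costDw w w' c alpha :
  cost (fun i => w i + c * w' i) alpha = cost w alpha + c * cost w' alpha.
Proof. by rewrite mulr_sumr -big_split; apply: eq_bigr => i _ /=; ring. Qed.

Lemma cost_delta w i : cost w (delta_mx 0 i) = w i.
Proof.
rewrite /cost (bigD1 i)//= mxE !eqxx mul1r big1 ?addr0// => j /negbTE ji.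
by rewrite mxE ji andbF mul0r.
Qed.

Lemma cost1 alpha : cost (fun=> 1) alpha = \sum_i alpha 0 i.
Proof. by apply: eq_bigr => i _; rewrite mulr1. Qed.

Lemma baryD alpha beta : bary (alpha + beta) = bary alpha + bary beta.
Proof. by rewrite -big_split; apply: eq_bigr => i _; rewrite mxE scalerDl. Qed.

Lemma baryZ c alpha : bary (c *: alpha) = c *: bary alpha.
Proof. by rewrite scaler_sumr; apply: eq_bigr => i _; rewrite mxE scalerA. Qed.

Lemma bary_delta i : bary (delta_mx 0 i) = p i.
Proof.
rewrite /bary (bigD1 i)//= mxE !eqxx scale1r big1 ?addr0// => j /negbTE ji.
by rewrite mxE ji andbF scale0r.
Qed.

Lemma dot_bary alpha x : dot (bary alpha) x = cost (fun i => dot (p i) x) alpha.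
Proof. by rewrite dot_suml; apply: eq_bigr => i _; rewrite dotZl. Qed.

Lemma simplexP alpha :
  simplex alpha <-> (forall i, 0 <= alpha 0 i) /\ cost (fun=> 1) alpha = 1.
Proof.
rewrite cost1; split=> [[h ?]|[h s]]; split=> // i; first by case/andP: (h i).
by rewrite h -s (bigD1 i)//= lerDl sumr_ge0.
Qed.

Lemma simplex_ge0 alpha i : simplex alpha -> 0 <= alpha 0 i.
Proof. by move=> /simplexP[]. Qed.

Lemma simplex_delta i : simplex (delta_mx 0 i : 'rV[R]_m.+1).
Proof. by apply/simplexP; split=> [j|]; rewrite ?cost_delta// mxE ler0n. Qed.

Lemma simplex_conv alpha beta (s : R) : simplex alpha -> simplex beta ->
  0 <= s <= 1 -> simplex ((1 - s) *: alpha + s *: beta).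
Proof.
move=> /simplexP[a0 a1] /simplexP[b0 b1] /andP[s0 s1]; apply/simplexP; split=> [i|].
  by rewrite !mxE addr_ge0// mulr_ge0// subr_ge0.
by rewrite costD !costZ a1 b1; ring.
Qed.

Lemma le_cost w w' alpha : simplex alpha -> (forall i, 0 < alpha 0 i -> w i <= w' i) ->
  cost w alpha <= cost w' alpha.
Proof.
move=> /simplexP[a0 _] h; apply: ler_sum => i _.
have := a0 i; rewrite le_eqVlt => /orP[/eqP <-|ai]; first by rewrite !mul0r.
by apply: ler_wpM2l; [exact: ltW|exact: h].
Qed.

Lemma cost_const c alpha : simplex alpha -> cost (fun=> c) alpha = c.
Proof.
by move=> /simplexP[_ a1]; rewrite -[RHS]mulr1 -a1 mulr_sumr; apply: eq_bigr => i _; ring.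
Qed.

Lemma eq_cost w w' alpha : simplex alpha -> (forall i, 0 < alpha 0 i -> w i = w' i) ->
  cost w alpha = cost w' alpha.
Proof. by move=> sa h; apply/eqP; rewrite eq_le !le_cost// => i /h ->. Qed.

Lemma continuous_cost w : continuous (cost w).
Proof.
apply: continuous_sum => i x.
by apply: continuousM; [exact: (@coord_continuous _ _ _ 0 i)|exact: cst_continuous].
Qed.

Lemma simplex_compact : compact (@simplex R m.+1).
Proof.
apply: bounded_closed_compact.
  apply: (@norm_le_bounded_set _ _ _ 1) => x [hx _]; apply: norm_le_coord => // i.
  by case/andP: (hx i) => ? ?; rewrite ger0_norm.
rewrite (_ : @simplex R m.+1 =
  (\bigcap_(i in [set: 'I_m.+1]) [set x : 'rV_m.+1 | 0 <= x 0 i]) `&`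
  [set x | cost (fun=> 1) x = 1]); last first.
  apply/seteqP; split=> x; first by move=> /simplexP[h h1]; split=> // i _; exact: h.
  by move=> [h h1]; apply/simplexP; split=> // i; exact: h.
apply: closedI.
  apply: closed_bigI => i _.
  apply: (@preimage_closed _ _ (fun x : 'rV[R]_m.+1 => x 0 i) [set y | 0 <= y]).
    by move=> x _; exact: (@coord_continuous _ _ _ 0 i).
  exact: closed_ge.
apply: (@preimage_closed _ _ (cost (fun=> 1)) [set y | y = 1]).
  by move=> x _; exact: continuous_cost.
exact: closed_eq.
Qed.

Lemma feasible_compact q : compact (feasible p q).
Proof.
rewrite (_ : feasible p q = @simplex R m.+1 `&`
  \bigcap_(k in [set: 'I_n]) [set x : 'rV_m.+1 | cost (fun i => p i 0 k) x = q 0 k]).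
  apply: compact_closedI; first exact: simplex_compact.
  apply: closed_bigI => k _.
  apply: (@preimage_closed _ _ (cost (fun i => p i 0 k)) [set y | y = q 0 k]).
    by move=> x _; exact: continuous_cost.
  exact: closed_eq.
have baryE (x : 'rV[R]_m.+1) k : (\sum_i x 0 i *: p i) 0 k = cost (fun i => p i 0 k) x.
  by rewrite summxE; apply: eq_bigr => i _; rewrite mxE.
apply/seteqP; split=> x [sx h]; split=> //.
  by move=> k _ /=; rewrite -baryE h.
by apply/rowP => k; rewrite baryE h.
Qed.

(** The extreme value theorem is used twice: for [gamma] on the compact feasible set, then for
    [theta] on the compact set of its minimizers. *)
Lemma minimizers_lexi gamma theta q : feasible p q !=set0 ->
  exists2 alpha, minimizers p gamma q alpha &
    forall beta, minimizers p gamma q beta -> cost theta alpha <= cost theta beta.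
Proof.
move=> fq; have cw w A : {within A, continuous (cost w)}.
  by apply: continuous_subspaceT; exact: continuous_cost.
have [a aq amin] := compact_EVT_min fq (@feasible_compact q) (cw gamma _).
have cA : compact (feasible p q `&` [set x | cost gamma x <= cost gamma a]).
  apply: compact_closedI; first exact: feasible_compact.
  apply: (@preimage_closed _ _ (cost gamma) [set y | y <= cost gamma a]).
    by move=> x _; exact: continuous_cost.
  exact: closed_le.
have [|b bA bmin] := compact_EVT_min _ cA (cw theta _).
  by exists a; split=> /=; [rewrite inE in aq|].
move: bA; rewrite inE => -[bq /= ba]; exists b.
  by split=> // c cq; rewrite (le_trans ba)// amin// inE.
move=> c [cq cmin]; apply: bmin; rewrite inE; split=> //=; apply: cmin.
by rewrite inE in aq.
Qed.

End Polyhedral.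

(** * Separation and duality *)

Section Separation.
Context {R : realType} {m : nat} {V : lmodType R}.

(** Homogenization: Farkas' lemma is applied on [V * R], where the added coordinate forces total
    mass one. Indices outside [S] get the zero constraint and their multipliers are discarded. *)
Lemma conv_sep (S : pred 'I_m.+1) (a : 'I_m.+1 -> V -> R) (b : V -> R) :
  (forall i, functional (a i)) -> functional b ->
  (forall h, exists2 i, S i & b h <= a i h) ->
  exists alpha : 'rV[R]_m.+1, [/\ simplex alpha, forall i, 0 < alpha 0 i -> S i &
    forall h, b h = cost (a^~ h) alpha].
Proof.
move=> la lb hab.
pose A i (z : V * R^o) := if S i then a i z.1 - z.2 else 0.
pose B (z : V * R^o) := b z.1 - z.2.
have lA i : functional (A i).
  move=> c x y; rewrite /A; case: ifP => _ /=; last by rewrite mulr0 addr0.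
  by rewrite la /GRing.scale/=; ring.
have lB : functional B by move=> c x y; rewrite /B/= lb /GRing.scale/=; ring.
have [[h c] hA|lam lam0 lamE] := farkas lA lB.
  have [i Si bi] := hab h; have := hA i; rewrite /A/B Si/=.
  by rewrite !subr_le0; exact: le_trans.
have E h c : b h - c = \sum_i (if S i then lam i else 0) * (a i h - c).
  rewrite [LHS](lamE (h, c)); apply: eq_bigr => i _; rewrite /A/=.
  by case: ifP; rewrite ?mulr0 ?mul0r.
have b0 : b 0 = 0 by rewrite -(scale0r 0) functionalZ// mul0r.
have a0 i : a i 0 = 0 by rewrite -(scale0r 0) functionalZ// mul0r.
exists (\row_i if S i then lam i else 0); split=> [|i|h].
- apply/simplexP; split=> [i|]; first by rewrite mxE; case: ifP.
  have := E 0 (-1); rewrite b0 sub0r opprK => E1; rewrite [RHS]E1; apply: eq_bigr => i _.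
  by rewrite a0 add0r mxE.
- by rewrite mxE; case: ifP => //; rewrite ltxx.
- have := E h 0; rewrite subr0 => ->; apply: eq_bigr => i _.
  by rewrite subr0 mxE.
Qed.

End Separation.

Section Duality.
Context {R : realType} {m n : nat}.
Variables (p : 'I_m.+1 -> 'rV[R]_n) (theta gamma : 'I_m.+1 -> R).
Implicit Types (alpha beta : 'rV[R]_m.+1) (q x : 'rV[R]_n) (t : R).

Definition neuron i x t : R := dot (p i) x - t * theta i - gamma i.

Lemma feasibleP q alpha : feasible p q alpha <-> simplex alpha /\ bary p alpha = q.
Proof. by []. Qed.

Lemma cost_neuron alpha x t :
  cost (fun i => neuron i x t) alpha =
  dot (bary p alpha) x - t * cost theta alpha - cost gamma alpha.
Proof.
rewrite dot_bary /cost mulr_sumr -!sumrB.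
by apply: eq_bigr => i _; rewrite /neuron; ring.
Qed.

(** Complementary slackness: the average of [dot (p i) x - gamma i] equals [J x] for [alpha] and is
    at most [J x] for any competitor, and the terms in [x] agree because the barycentres do. *)
Lemma active_minimizers alpha x : simplex alpha ->
  (forall i, 0 < alpha 0 i -> dot (p i) x - gamma i = J p gamma x) ->
  minimizers p gamma (bary p alpha) alpha.
Proof.
move=> sa act; split=> // beta /feasibleP[sb bq].
have cE be : cost (fun i => dot (p i) x - gamma i) be = dot (bary p be) x - cost gamma be.
  by rewrite dot_bary /cost -sumrB; apply: eq_bigr => i _; ring.
have : cost (fun i => dot (p i) x - gamma i) alpha = J p gamma x.
  by rewrite -[RHS](cost_const _ sa); exact: eq_cost.
have : cost (fun i => dot (p i) x - gamma i) beta <= J p gamma x.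
  rewrite -[leRHS](cost_const _ sb); apply: le_cost => // i _.
  exact: (le_max_ord (fun i => dot (p i) x - gamma i)).
by rewrite !cE// bq -/(cost gamma alpha) -/(cost gamma beta); lra.
Qed.

(** On the support of [alpha] there is room for a small decrease; off the support [nu] can only
    increase the weights. *)
Lemma perturb_simplex alpha (nu : 'rV[R]_m.+1) : simplex alpha ->
  cost (fun=> 1) nu = 0 -> (forall i, ~~ (0 < alpha 0 i) -> 0 <= nu 0 i) ->
  exists2 e : R, 0 < e & simplex (alpha + e *: nu).
Proof.
move=> /simplexP[a0 a1] nu0 nuge.
have [|e e0 he] := @near_right0_ex R (fun e => forall i, 0 <= alpha 0 i + e * nu 0 i).
  apply: filter_forall => i; have [ai|ai] := boolP (0 < alpha 0 i); last first.
    apply: filterS (nbhs_right_gt 0) => e e0.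
    by rewrite addr_ge0// mulr_ge0// ?nuge// ltW.
  have /(@nbhs_right_lt R 0) : 0 < alpha 0 i / (`|nu 0 i| + 1).
    by rewrite divr_gt0// ltr_wpDl.
  apply: filterS2 (nbhs_right_gt 0) => e e0.
  rewrite ltr_pdivlMr ?ltr_wpDl// => h.
  have := ler_norm (- nu 0 i); rewrite normrN; nra.
exists e => //; apply/simplexP; split=> [i|]; first by rewrite !mxE.
by rewrite costD costZ nu0 a1; lra.
Qed.

(* If there is no such point [(x, t)], Motzkin's multipliers form a direction [nu]
   such that [alpha + e nu], for small [e > 0], contradicts one of the hypotheses. *)
Lemma lexi_certificate q alpha (P : pred 'I_m.+1) :
  minimizers p gamma q alpha ->
  (forall beta, minimizers p gamma q beta -> cost theta alpha <= cost theta beta) ->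
  (forall i, P i -> forall beta, minimizers p gamma q beta ->
     cost theta beta <= cost theta alpha -> beta 0 i = 0) ->
  exists x t, [/\ 0 < t, forall i, neuron i x t <= f p theta gamma (x, t),
    forall i, 0 < alpha 0 i -> neuron i x t = f p theta gamma (x, t) &
    forall i, P i -> neuron i x t < f p theta gamma (x, t)].
Proof.
move=> amin alex aP; have [/feasibleP[sa aq] amin'] := amin.
(* Homogenized neurons: [s] multiplies [gamma], and [c] stands for the value of [f]. *)
pose A i (z : 'rV[R]_n * R^o * R^o * R^o) : R :=
  dot (p i) z.1.1.1 - z.1.1.2 * gamma i - z.1.2 * theta i - z.2.
(* The constraints say in turn that no neuron exceeds [c], that those carried by [alpha] reach it,
   and that [s] and [t] are nonnegative. [Q] makes the last two strict, and the first one for [i] in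
   [P]. *)
pose a (k : 'I_m.+1 + 'I_m.+1 + bool) (z : 'rV[R]_n * R^o * R^o * R^o) : R :=
  match k with
  | inl (inl i) => A i z
  | inl (inr i) => if 0 < alpha 0 i then - A i z else 0
  | inr true => - z.1.1.2
  | inr false => - z.1.2
  end.
pose Q (k : 'I_m.+1 + 'I_m.+1 + bool) :=
  match k with inl (inl i) => P i | inl (inr _) => false | inr _ => true end.
have lA i : functional (A i).
  by move=> c x y; rewrite /A/= dotDr dotZr /GRing.scale/=; ring.
have la k : functional (a k).
  move=> c x y; case: k => [[i|i]|[]] /=; rewrite ?lA//; last 2 first.
  - by rewrite /GRing.scale/=; ring.
  - by rewrite /GRing.scale/=; ring.
  by case: ifP => _; ring.
have [[[[[x s] t] c] hle hlt]|[lam [lam0 lamE [k Qk lamk]]]] := motzkin Q la.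
  have s0 : 0 < s by have := hlt (inr true) erefl; rewrite /= oppr_lt0.
  have t0 : 0 < t by have := hlt (inr false) erefl; rewrite /= oppr_lt0.
  (* Dividing by [s > 0] gives the point [(x / s, t / s)], where [f] takes the value [c / s]. *)
  have AE i : A i (x, s, t, c) = s * (neuron i (s^-1 *: x) (t / s) - c / s).
    by rewrite /A/neuron/= dotZr; field; rewrite gt_eqF.
  have [i ai] : exists i, 0 < alpha 0 i.
    apply/not_existsP => h; have [a0 a1] := (simplexP alpha).1 sa.
    have : cost (fun=> 1) alpha = 0.
      apply: big1 => i _; have := h i; have := a0 i.
      by rewrite le_eqVlt => /orP[/eqP <-|//]; rewrite mul0r.
    by rewrite a1; move/eqP; rewrite oner_eq0.
  have le_c j : neuron j (s^-1 *: x) (t / s) <= c / s.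
    have := hle (inl (inl j)); rewrite /= AE pmulr_rle0//; lra.
  have eq_c j : 0 < alpha 0 j -> neuron j (s^-1 *: x) (t / s) = c / s.
    move=> aj; apply/eqP; rewrite eq_le le_c/=.
    have := hle (inl (inr j)); rewrite /= aj AE oppr_le0 pmulr_rge0//; lra.
  have fE : f p theta gamma (s^-1 *: x, t / s) = c / s.
    apply/eqP; rewrite eq_le; apply/andP; split; first exact/max_ord_le.
    rewrite -(eq_c _ ai).
    exact: (le_max_ord (fun i => neuron i (s^-1 *: x) (t / s))).
  exists (s^-1 *: x), (t / s); rewrite fE; split=> [|//|//|j Pj].
    exact: divr_gt0.
  have := hlt (inl (inl j)) Pj; rewrite /= AE pmulr_rlt0//; lra.
(* Second alternative: evaluating the vanishing combination at coordinate vectors shows that [nu]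
   has mass and barycentre zero, and that its two costs are minus the multipliers of [s] and [t]. *)
exfalso; pose mu i := if 0 < alpha 0 i then lam (inl (inr i)) else 0.
pose nu : 'rV[R]_m.+1 := \row_i (lam (inl (inl i)) - mu i).
have nuE (z : 'rV[R]_n * R^o * R^o * R^o) :
    cost (A^~ z) nu = lam (inr true) * z.1.1.2 + lam (inr false) * z.1.2.
  have := lamE z; rewrite big_sumType/= big_sumType/= big_bool/=.
  rewrite [X in _ + X + _](_ : _ = - \sum_i mu i * A i z).
    rewrite -sumrB/= => h; rewrite /cost.
    under eq_bigr => i _ do rewrite mxE mulrBl.
    by move: h; lra.
  by rewrite -sumrN; apply: eq_bigr => i _; rewrite /mu; case: ifP => _; ring.
have nu1 : cost (fun=> 1) nu = 0.
  have := nuE (0, 0, 0, -1); rewrite /= !mulr0 addr0 => <-.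
  by apply: eq_bigr => i _; rewrite /A/= dot0r; ring.
have nug : cost gamma nu = - lam (inr true).
  have := nuE (0, 1, 0, 0); rewrite /= mulr0 mulr1 addr0 => <-.
  by rewrite -sumrN; apply: eq_bigr => i _; rewrite /A/= dot0r; ring.
have nut : cost theta nu = - lam (inr false).
  have := nuE (0, 0, 1, 0); rewrite /= mulr0 mulr1 add0r => <-.
  by rewrite -sumrN; apply: eq_bigr => i _; rewrite /A/= dot0r; ring.
have nup : bary p nu = 0.
  apply: dot_inj => w; rewrite dot0l dot_bary.
  have := nuE (w, 0, 0, 0); rewrite /= !mulr0 addr0 => <-.
  by apply: eq_bigr => i _; rewrite /A/=; ring.
have [|e e0 se] := perturb_simplex sa nu1.
  by move=> i /negbTE ai; rewrite mxE /mu ai subr0.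
have feas : feasible p q (alpha + e *: nu).
  by apply/feasibleP; split=> //; rewrite baryD baryZ nup scaler0 addr0.
(* Optimality of [alpha] for [gamma], then for [theta] among minimizers, kills these two
   multipliers. The positive one then sits at some [i] in [P], where [alpha] vanishes but its
   perturbation, again a lexicographic minimizer, does not. *)
have l1 : lam (inr true) = 0.
  have := amin' _ feas; rewrite -/(cost gamma alpha) -/(cost gamma (alpha + e *: nu)).
  rewrite costD costZ nug; have := lam0 (inr true); nra.
have mine : minimizers p gamma q (alpha + e *: nu).
  split=> // beta bq; rewrite -/(cost gamma (_ + _)) costD costZ nug l1 oppr0 mulr0 addr0.
  exact: amin'.
have l2 : lam (inr false) = 0.
  have := alex _ mine; rewrite costD costZ nut; have := lam0 (inr false); nra.
case: k Qk lamk => [[i|//]|[]] /=; last 2 first.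
- by rewrite l1 ltxx.
- by rewrite l2 ltxx.
move=> Pi li; have /(aP i Pi alpha amin) ai := lexx (cost theta alpha).
have := aP i Pi _ mine; rewrite costD costZ nut l2 oppr0 mulr0 addr0 => /(_ (lexx _)).
by rewrite !mxE /mu ai ltxx; have : 0 < e * lam (inl (inl i)); [exact: mulr_gt0|lra].
Qed.

End Duality.

(** * The Hamiltonian *)

Section Consequences.
Context {R : realType} {m n : nat}.
Variables (p : 'I_m.+1 -> 'rV[R]_n) (theta gamma : 'I_m.+1 -> R).
Implicit Types (alpha beta : 'rV[R]_m.+1) (q x : 'rV[R]_n) (t : R).

Lemma convex_jensen (g : 'rV[R]_n -> R) alpha :
  convex_function [set: 'rV[R]_n] g -> simplex alpha ->
  g (bary p alpha) <= cost (g \o p) alpha.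
Proof.
move=> cg /simplexP[a0 a1].
have cg2 (s : R) u v : 0 <= s -> s <= 1 ->
    g (s *: u + (1 - s) *: v) <= s * g u + (1 - s) * g v.
  by move=> s0 s1; apply: (cg (Itv01 s0 s1)); rewrite inE.
(* Induction over lists of indices, with the weights renormalized by their partial mass. *)
suff H (r : seq 'I_m.+1) : 0 < \sum_(i <- r) alpha 0 i ->
    g ((\sum_(i <- r) alpha 0 i)^-1 *: \sum_(i <- r) alpha 0 i *: p i) <=
    (\sum_(i <- r) alpha 0 i)^-1 * \sum_(i <- r) alpha 0 i * g (p i).
  have := H (index_enum _); rewrite -cost1 a1 invr1 scale1r mul1r.
  by apply; exact: ltr01.
elim: r => [|k r IH]; first by rewrite big_nil ltxx.
rewrite !big_cons; set A := \sum_(i <- r) alpha 0 i.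
have := a0 k; rewrite le_eqVlt => /orP[/eqP <-|ak _].
  by rewrite add0r scale0r add0r mul0r add0r; exact: IH.
have : 0 <= A by exact: sumr_ge0.
rewrite le_eqVlt => /orP[/eqP A0|A0].
  have ai i : i \in r -> alpha 0 i = 0.
    move=> ir; apply/eqP; rewrite -[_ == 0]negbK; apply/negP => ai.
    suff : 0 < A by rewrite -A0 ltxx.
    by rewrite /A (big_rem i)//= ltr_wpDr ?sumr_ge0// lt_neqAle eq_sym ai a0.
  rewrite -A0 addr0 !big1_seq ?addr0; last 2 first.
  - by move=> i /andP[_ /ai ->]; rewrite mul0r.
  - by move=> i /andP[_ /ai ->]; rewrite scale0r.
  by rewrite scalerA mulrA mulVf ?gt_eqF// scale1r mul1r.
have sA : 0 < alpha 0 k + A by exact: addr_gt0.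
have s0 : 0 <= alpha 0 k / (alpha 0 k + A) by rewrite divr_ge0// ltW.
have s1 : alpha 0 k / (alpha 0 k + A) <= 1 by rewrite ler_pdivrMr// mul1r lerDl ltW.
have := cg2 _ (p k) (A^-1 *: \sum_(i <- r) alpha 0 i *: p i) s0 s1.
have E : 1 - alpha 0 k / (alpha 0 k + A) = A / (alpha 0 k + A).
  by field; rewrite gt_eqF.
rewrite E scalerA (_ : A / _ / A = (alpha 0 k + A)^-1); last first.
  by field; rewrite !gt_eqF.
rewrite mulrC -scalerA -scalerDr => /le_trans; apply.
rewrite mulrDr mulrA [_^-1 * _]mulrC lerD2l [in leRHS]mulrC.
have := IH A0; rewrite -/A => /(ler_wpM2l (ltW A0)); rewrite mulVKf ?gt_eqF//.
move=> h; rewrite mulrAC ler_wpM2r// invr_ge0; exact: ltW.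
Qed.

(** Weights with barycentre [q] bound the transform at [q] by their [gamma]-cost. Conversely, when
    no such weights exist, [conv_sep] yields a direction [h] along which [dot q x - J x] grows
    linearly. *)
Lemma domJstarP q : q \in domJstar p gamma <-> feasible p q !=set0.
Proof.
rewrite inE /domJstar /edom/=; split; last first.
  move=> [alpha /feasibleP[sa <-]]; apply: (@le_lt_trans _ _ (cost gamma alpha)%:E).
    apply: ub_ereal_sup => _ [x _ <-] /=; rewrite lee_fin dot_bary.
    rewrite lerBlDr -(cost_const (J p gamma x) sa).
    have -> : cost gamma alpha + cost (fun=> J p gamma x) alpha =
        cost (fun i => gamma i + 1 * J p gamma x) alpha by rewrite costDw mul1r.
    apply: le_cost => // i _; rewrite mul1r -lerBlDl.
    exact: (le_max_ord (fun i => dot (p i) x - gamma i)).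
  exact: ltry.
move=> fin.
have lin q' : functional (dot q') by move=> c x y; rewrite dotDr dotZr.
have [hsep|] := pselect (forall h, exists2 i, xpredT i & dot q h <= dot (p i) h).
  have [alpha [sa _ aE]] := conv_sep (fun i => lin (p i)) (lin q) hsep.
  by exists alpha; apply/feasibleP; split=> //; apply: dot_inj => h; rewrite dot_bary aE.
move=> /existsNP[h hh]; exfalso.
have [k kE] := max_ordP (fun i => dot (p i) h).
pose d := dot q h - dot (p k) h.
have d0 : 0 < d by rewrite subr_gt0 ltNge; apply/negP => hk; apply: hh; exists k.
have hd i : dot (p i) h + d <= dot q h.
  have := le_max_ord (fun i => dot (p i) h) i; rewrite kE /d; lra.
have ge x : (((dot q x - J p gamma x)%:E <= fenchel (EFin \o J p gamma) q))%E.
  by apply: ereal_sup_ubound; exists x.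
move: fin ge; case: (fenchel _ q) => [B _ ge||_ /(_ 0)]; last 2 first.
- by rewrite ltxx.
- by rewrite leeNy_eq.
pose G := max_ord (fun i => - gamma i).
(* Along [h] the quantity [dot q x - J x] is at least [s * d - G], which exceeds the supposed bound
   [B] for this [s]. *)
pose s := (`|B| + `|G| + 1) / d.
have s0 : 0 <= s by apply: divr_ge0; [rewrite !addr_ge0|exact: ltW].
have := ge (s *: h); rewrite lee_fin /J.
have [i ->] := max_ordP (fun i => dot (p i) (s *: h) - gamma i).
rewrite !dotZr => le1; have := le_max_ord (fun i => - gamma i) i.
rewrite -/G => le2; have le3 := ler_wpM2l s0 (hd i).
have sd : s * d = `|B| + `|G| + 1 by rewrite divfK// gt_eqF.
move: le3; rewrite mulrDr sd; have := ler_norm B; have := ler_norm G; lra.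
Qed.

Lemma H_le q alpha : minimizers p gamma q alpha ->
  (H p theta gamma q <= (cost theta alpha)%:E)%E.
Proof.
move=> amin; have qD : q \in domJstar p gamma by apply/domJstarP; exists alpha; case: amin.
by rewrite /H qD; apply: ereal_inf_lbound; exists alpha.
Qed.

Lemma H_ge q c : (forall alpha, minimizers p gamma q alpha -> c <= cost theta alpha) ->
  (c%:E <= H p theta gamma q)%E.
Proof.
move=> hc; rewrite /H; case: ifP => _; last exact: leey.
by apply: le_ereal_inf_tmp => _ [alpha amin <-]; rewrite lee_fin; exact: hc.
Qed.

(** A lexicographic minimizer attains the infimum defining [H]. *)
Lemma H_lexi q : q \in domJstar p gamma ->
  exists alpha, [/\ minimizers p gamma q alpha,
    forall beta, minimizers p gamma q beta -> cost theta alpha <= cost theta beta &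
    H p theta gamma q = (cost theta alpha)%:E].
Proof.
move=> /domJstarP/(minimizers_lexi gamma theta)[alpha amin alex].
exists alpha; split=> //; apply/eqP; rewrite eq_le; apply/andP; split.
  exact: H_le.
exact: H_ge.
Qed.

(** Whether dual optimality holds at [y] depends only on the support of the minimizer, so one dual
    point per support suffices. Finiteness of the family is what later gives uniform constants. *)
Lemma dual_family : exists Y : {set 'I_m.+1} -> 'rV[R]_n, forall q alpha,
  minimizers p gamma q alpha -> forall i, 0 < alpha 0 i ->
  dot (p i) (Y [set j | 0 < alpha 0 j]%SET) - gamma i =
  J p gamma (Y [set j | 0 < alpha 0 j]%SET).
Proof.
have : forall S : {set 'I_m.+1}, exists y : 'rV[R]_n, forall q alpha,
    minimizers p gamma q alpha -> [set j | 0 < alpha 0 j]%SET = S ->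
    forall i, i \in S -> dot (p i) y - gamma i = J p gamma y.
  move=> S; have [[q0 [alpha0 [amin aS]]]|no] := pselect (exists q alpha,
      minimizers p gamma q alpha /\ [set j | 0 < alpha 0 j]%SET = S); last first.
    by exists 0 => q alpha amin aS; exfalso; apply: no; exists q, alpha.
  (* With [theta] replaced by zero, time disappears from the neurons and [f] reduces to [J]. *)
  have [||y [t [_ _ act _]]] := @lexi_certificate _ _ _ p (fun=> 0) gamma _ _ pred0 amin.
  - by move=> beta _; rewrite /cost !big1// => i _; rewrite mulr0.
  - by [].
  exists y => q alpha _ _ i; rewrite -aS inE => /act.
  rewrite /f /neuron /J /= mulr0 subr0 => ->; congr max_ord.
  by apply/funext => j; rewrite subr0.
move=> /choice[Y hY]; exists Y => q alpha amin i ai.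
by apply: (hY _ q alpha) => //; rewrite inE.
Qed.

Hypotheses (hA2 : assumptionA2 p gamma) (hA3 : assumptionA3 p theta gamma).

(** Jensen's inequality for the convex interpolant [g] of (A2). *)
Lemma gamma_le_cost i alpha : feasible p (p i) alpha -> gamma i <= cost gamma alpha.
Proof.
case: hA2 => g cg gE /feasibleP[sa aE].
have := convex_jensen cg sa; rewrite aE gE => /le_trans; apply.
by apply: le_cost => // j _; rewrite /= gE.
Qed.

Lemma delta_minimizers i : minimizers p gamma (p i) (delta_mx 0 i).
Proof.
split; first by apply/feasibleP; rewrite bary_delta; split=> //; exact: simplex_delta.
by move=> beta bp; rewrite -/(cost gamma (delta_mx 0 i)) cost_delta; exact: gamma_le_cost.
Qed.

(** Removing the mass at [i] and renormalizing gives weights [beta] vanishing at [i], with the same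
    barycentre [p i] and the same [gamma]-cost [gamma i]; (A3) applies to them. *)
Lemma lt_cost_minimizers i j alpha : minimizers p gamma (p i) alpha ->
  j != i -> 0 < alpha 0 j -> theta i < cost theta alpha.
Proof.
move=> amin ji aj; have [/feasibleP[sa aE] _] := amin.
have [a0 a1] := (simplexP alpha).1 sa.
have cE : cost gamma alpha = gamma i.
  apply/eqP; rewrite eq_le gamma_le_cost ?andbT; last by case: amin.
  have := amin.2 (delta_mx 0 i) (delta_minimizers i).1.
  by rewrite -/(cost _ _) -/(cost _ (delta_mx 0 i)) cost_delta.
have ai1 : alpha 0 i < 1.
  move: a1; rewrite cost1 (bigD1 i)//= (bigD1 j)//=.
  have : 0 <= \sum_(k | (k != i) && (k != j)) alpha 0 k by exact: sumr_ge0.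
  by move: aj; lra.
pose beta := (1 - alpha 0 i)^-1 *: (alpha + (- alpha 0 i) *: delta_mx 0 i).
have b1 : 1 - alpha 0 i != 0 by rewrite gt_eqF// subr_gt0.
have costb w : cost w beta = (cost w alpha - alpha 0 i * w i) / (1 - alpha 0 i).
  by rewrite /beta costZ costD costZ cost_delta mulNr mulrC.
have bi : beta 0 i = 0 by rewrite !mxE !eqxx mulr1 addrN mulr0.
have sb : simplex beta.
  apply/simplexP; split=> [k|]; last by rewrite costb a1 mulr1 divff.
  have [->|ki] := eqVneq k i; first by rewrite bi.
  rewrite !mxE eqxx (negbTE ki) mulr0 addr0 mulr_ge0// invr_ge0; lra.
have sumE w : \sum_(k | k != i) beta 0 k * w k = cost w beta.
  by rewrite /cost [in RHS](bigD1 i)//= bi mul0r add0r.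
have := hA3 sb bi; rewrite !sumE !costb cE => h.
have : theta i < (cost theta alpha - alpha 0 i * theta i) / (1 - alpha 0 i).
  apply: h; last by field.
  rewrite (_ : \sum_(_ | _) _ = bary p beta); last first.
    by rewrite /bary [in RHS](bigD1 i)//= bi scale0r add0r.
  rewrite /beta baryZ baryD baryZ bary_delta -/(bary p alpha) in aE *.
  by rewrite aE -{1}(scale1r (p i)) -scalerDl scalerA mulVf// scale1r.
rewrite ltr_pdivlMr ?subr_gt0//; lra.
Qed.

Lemma theta_le_cost i alpha : minimizers p gamma (p i) alpha -> theta i <= cost theta alpha.
Proof.
move=> amin; have [[j [ji aj]]|no] := pselect (exists j, j != i /\ 0 < alpha 0 j).
  exact: ltW (lt_cost_minimizers amin ji aj).
have [[sa _] _] := amin; rewrite -(cost_const (theta i) sa) le_cost// => j aj.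
by have [->//|ji] := eqVneq j i; exfalso; apply: no; exists j.
Qed.

Lemma H_vertex i : H p theta gamma (p i) = (theta i)%:E.
Proof.
apply/eqP; rewrite eq_le; apply/andP; split.
  by rewrite -(cost_delta theta i); apply/H_le/delta_minimizers.
by apply: H_ge => alpha; exact: theta_le_cost.
Qed.

(** The Dirac weight at [i] is the only lexicographic minimizer over [p i], so the certificate may
    demand strictness at all the other neurons. *)
Lemma strictly_active_point i : exists x t, 0 < t /\
  forall j, j != i -> neuron p theta gamma j x t < neuron p theta gamma i x t.
Proof.
have [||x [t [t0 _ act strict]]] :=
    @lexi_certificate _ _ _ p theta gamma _ _ (fun j => j != i) (delta_minimizers i).
- by move=> beta /theta_le_cost; rewrite cost_delta.
- move=> j ji beta bmin; rewrite cost_delta => bi.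
  apply/eqP; rewrite -[_ == _]negbK; apply/negP => bj.
  have [[sb _] _] := bmin.
  have := @lt_cost_minimizers i j beta bmin ji; rewrite lt_neqAle eq_sym bj simplex_ge0//.
  by move=> /(_ isT); rewrite ltNge bi.
exists x, t; split=> // j ji; rewrite [ltRHS]act; first exact: strict.
by rewrite mxE !eqxx ltr01.
Qed.

(* Near the vertex [p i], a segment starting at [p i] stays in one cell of the
   subdivision of [domJstar] induced by [J], on which minimizers can be mixed. *)
Lemma radial_minimizers i (weights : 'rV[R]_m.+1) : simplex weights ->
  exists2 l : R, 0 < l <= 1 & exists2 beta,
    bary p beta = (1 - l) *: p i + l *: bary p weights &
    simplex beta /\ forall s : R, 0 <= s <= 1 ->
      minimizers p gamma (bary p ((1 - s) *: delta_mx 0 i + s *: beta))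
        ((1 - s) *: delta_mx 0 i + s *: beta).
Proof.
move=> sg; have [Y hY] := dual_family.
pose pb := bary p weights; pose y0 := Y [set j | 0 < (delta_mx 0 i : 'rV[R]_m.+1) 0 j]%SET.
have y0i : dot (p i) y0 - gamma i = J p gamma y0.
  by apply: (hY _ _ (delta_minimizers i)); rewrite mxE !eqxx ltr01.
(* [gap S] measures how far [p i] is from being active at the dual point [Y S]. For [l] small, none
   of the finitely many positive gaps can be closed by moving from [p i] a fraction [l] of the way
   to [pb]. *)
pose gap S := J p gamma (Y S) - (dot (p i) (Y S) - gamma i).
have gap0 S : 0 <= gap S.
  by rewrite subr_ge0; exact: (le_max_ord (fun i => dot (p i) (Y S) - gamma i)).
have [|l l0 [l1 hl]] := @near_right0_ex R (fun l => l <= 1 /\ forall S, 0 < gap S ->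
    l * dot (pb - p i) (Y S - y0) < gap S).
  have small : \forall l \near (0 : R)^'+, forall S, 0 < gap S ->
      l * dot (pb - p i) (Y S - y0) < gap S.
    apply: filter_forall => S; set D := dot _ _.
    have [gS|_] := boolP (0 < gap S); last by apply: filterS (nbhs_right_gt 0) => ? _.
    have D1 : 0 < `|D| + 1 by rewrite ltr_wpDl.
    have /(@nbhs_right_lt R 0) : 0 < gap S / (`|D| + 1) by exact: divr_gt0.
    apply: filterS2 (nbhs_right_gt 0) => l l0; rewrite ltr_pdivlMr// => h _.
    apply: le_lt_trans h; rewrite ler_wpM2l ?(ltW l0)//.
    by rewrite (le_trans (ler_norm _))// lerDl.
  by apply: filterS2 (nbhs_right_ltW ltr01) small => l l1 hl.
exists l; first by rewrite l0.
pose q := (1 - l) *: p i + l *: pb.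
have fq : feasible p q !=set0.
  exists ((1 - l) *: delta_mx 0 i + l *: weights); apply/feasibleP; split.
    by apply: simplex_conv => //; [exact: simplex_delta|rewrite (ltW l0)].
  by rewrite baryD !baryZ bary_delta.
have [beta bmin _] := minimizers_lexi gamma gamma fq.
have [[sb bq] _] := bmin; rewrite -/(bary p beta) in bq.
set S := [set j | 0 < beta 0 j]%SET; have actS := hY _ _ bmin; rewrite -/S in actS.
have costE : cost gamma beta = dot q (Y S) - J p gamma (Y S).
  rewrite -bq dot_bary -[X in _ - X](cost_const _ sb) -mulN1r -costDw.
  by apply: eq_cost => // j /actS <-; ring.
have cost_ge : dot q y0 - J p gamma y0 <= cost gamma beta.
  rewrite -bq dot_bary -[X in _ - X](cost_const _ sb) -mulN1r -costDw.
  apply: le_cost => // j _; rewrite mulN1r lerBlDl -lerBlDr.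
  exact: (le_max_ord (fun i => dot (p i) y0 - gamma i)).
(* The dual value at [Y S] is attained and the one at [y0] is a lower bound; their comparison gives
   [gap S <= l * dot (pb - p i) (Y S - y0)], which the choice of [l] excludes for a positive gap. *)
have gapS : gap S = 0.
  apply/eqP; rewrite eq_le gap0 andbT leNgt; apply/negP => /[dup] gS /hl.
  rewrite ltNge => /negP; apply; move: cost_ge; rewrite costE /gap /q -y0i.
  by rewrite !dotDl !dotZl !dotBr !dotNl; lra.
have acti : dot (p i) (Y S) - gamma i = J p gamma (Y S) by move: gapS; rewrite /gap; lra.
exists beta => //; split=> // s s01.
apply: (@active_minimizers _ _ _ _ _ _ (Y S)).
  by apply: simplex_conv => //; exact: simplex_delta.
move=> j; have [->//|ji] := eqVneq j i.
rewrite !mxE (negbTE ji) andbF mulr0 add0r => sbj; apply: actS.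
rewrite lt_neqAle eq_sym simplex_ge0// andbT.
by apply: contraTneq sbj => ->; rewrite mulr0 ltxx.
Qed.

End Consequences.

(** * Test functions *)

Section Gradient.
Context {R : realType} {n : nat}.
Local Notation T := ('rV[R]_n * R)%type.
Implicit Types (phi psi : T -> R) (g : T -> 'rV[R]_n) (tau : T -> R) (z h : T).

(** An explicit form of [C1]: [g] is the spatial gradient and [tau] the time derivative. Continuity
    is asked of directional derivatives, as in [C1], but at all times. *)
Definition has_gradient phi g tau := forall h,
  (forall z, differentiable phi z /\ 'D_h phi z = dot (g z) h.1 + tau z * h.2) /\
  continuous (fun z => dot (g z) h.1 + tau z * h.2).

Lemma has_gradient_C1 phi g tau : has_gradient phi g tau -> C1 phi.
Proof.
move=> hg z _; split=> [|h]; first by have [/(_ z)[]] := hg 0.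
rewrite (_ : (fun z' => _) = fun z => dot (g z) h.1 + tau z * h.2).
  by apply: (hg h).2.
by apply/funext => z'; exact: ((hg h).1 z').2.
Qed.

Lemma has_gradient_continuous phi g tau : has_gradient phi g tau -> continuous phi.
Proof. by move=> hg z; apply: differentiable_continuous; have [/(_ z)[]] := hg 0. Qed.

Lemma has_gradient_dt phi g tau z : has_gradient phi g tau -> dt phi z = tau z.
Proof.
by move=> hg; rewrite /dt ((hg _).1 z).2/= dot0r add0r mulr1.
Qed.

Lemma has_gradient_grad_x phi g tau z : has_gradient phi g tau -> grad_x phi z = g z.
Proof.
move=> hg; apply/rowP => i.
by rewrite mxE ((hg _).1 z).2/= dot_delta mulr0 addr0.
Qed.

Lemma has_gradient_ext phi psi g g' tau tau' :
  has_gradient phi g tau -> phi =1 psi -> g =1 g' -> tau =1 tau' ->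
  has_gradient psi g' tau'.
Proof. by move=> hg /funext <- /funext <- /funext <-. Qed.

Lemma has_gradientD phi psi g g' tau tau' :
  has_gradient phi g tau -> has_gradient psi g' tau' ->
  has_gradient (fun z => phi z + psi z) (fun z => g z + g' z) (fun z => tau z + tau' z).
Proof.
move=> hg hg' h; have [hz ch] := hg h; have [hz' ch'] := hg' h.
have E z : dot (g z + g' z) h.1 + (tau z + tau' z) * h.2 =
    (dot (g z) h.1 + tau z * h.2) + (dot (g' z) h.1 + tau' z * h.2).
  by rewrite dotDl; ring.
split=> [z|]; last first.
  rewrite (_ : (fun z => _) = fun z => (dot (g z) h.1 + tau z * h.2) +
    (dot (g' z) h.1 + tau' z * h.2)); last exact/funext.
  by move=> z; apply: cvgD; [exact: ch|exact: ch'].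
have [dz Dz] := hz z; have [dz' Dz'] := hz' z; split; first exact: differentiableD.
rewrite (_ : (fun z => _) = phi + psi)//.
by rewrite deriveD ?Dz ?Dz' ?E//; exact: diff_derivable.
Qed.

Lemma has_gradientZ c phi g tau : has_gradient phi g tau ->
  has_gradient (fun z => c * phi z) (fun z => c *: g z) (fun z => c * tau z).
Proof.
move=> hg h; have [hz ch] := hg h.
have E z : dot (c *: g z) h.1 + (c * tau z) * h.2 = c * (dot (g z) h.1 + tau z * h.2).
  by rewrite dotZl; ring.
split=> [z|]; last first.
  rewrite (_ : (fun z => _) = fun z => c * (dot (g z) h.1 + tau z * h.2)); last exact/funext.
  by move=> z; apply: cvgM; [exact: cvg_cst|exact: ch].
have [dz Dz] := hz z; split; first exact: differentiableZ.
rewrite (_ : (fun z => _) = c *: phi)//.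
by rewrite deriveZ ?Dz ?E//; exact: diff_derivable.
Qed.

Lemma continuous_dot (q : 'rV[R]_n) : continuous (dot q).
Proof.
apply: continuous_sum => i x.
by apply: continuousM; [exact: cst_continuous|exact: (@coord_continuous _ _ _ 0 i)].
Qed.

Lemma has_gradient_affine q (c b : R) :
  has_gradient (fun z => dot q z.1 + c * z.2 + b) (fun=> q) (fun=> c).
Proof.
pose L (z : T) : R^o := dot q z.1 + c * z.2.
have lL : linear L.
  by move=> a x y; rewrite /L/= dotDr dotZr /GRing.scale/=; ring.
pose LL : {linear T -> R^o} := HB.pack L (GRing.isLinear.Build R T R^o _ L lL).
have cL : continuous LL.
  move=> z; apply: (@cvgD _ R^o); first by
    apply: cvg_comp; [exact: cvg_fst|exact: continuous_dot].
  by apply: (@cvgM R); [exact: cvg_cst|exact: cvg_snd].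
move=> h; split=> [z|]; last by move=> z; exact: cvg_cst.
have dL : differentiable (LL : T -> R) z by exact: linear_differentiable.
have DL : 'D_h (LL : T -> R) z = L h by rewrite deriveE// diff_lin.
rewrite (_ : (fun z => _) = (LL : T -> R) + cst b)//; split.
  exact: differentiableD.
by rewrite deriveD ?derive_cst ?addr0//; exact: diff_derivable.
Qed.

(** Regularity of [rho] is asked only at the values of [phi], so that [ln] may be applied to a
    positive function. *)
Lemma has_gradient_comp phi g tau (rho rho' : R -> R) : has_gradient phi g tau ->
  (forall z, is_derive (phi z) (1 : R) rho (rho' (phi z))) ->
  (forall z, {for phi z, continuous rho'}) ->
  has_gradient (fun z => rho (phi z)) (fun z => rho' (phi z) *: g z)
    (fun z => rho' (phi z) * tau z).
Proof.
move=> hg hr cr h; have [hz ch] := hg h.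
have E z : dot (rho' (phi z) *: g z) h.1 + (rho' (phi z) * tau z) * h.2 =
    rho' (phi z) * (dot (g z) h.1 + tau z * h.2).
  by rewrite dotZl; ring.
split=> [z|]; last first.
  rewrite (_ : (fun z => _) = fun z => rho' (phi z) * (dot (g z) h.1 + tau z * h.2));
    last exact/funext.
  move=> z; apply: (@cvgM R); last exact: ch.
  apply: (@continuous_comp _ _ _ phi rho') => //.
  exact: (has_gradient_continuous hg).
have [dz Dz] := hz z.
have dr : differentiable rho (phi z) by apply/derivable1_diffP; case: (hr z).
split; first exact: (@differentiable_comp _ _ _ _ phi rho).
rewrite (_ : (fun z => _) = rho \o phi)// deriveE; last exact: differentiable_comp.
rewrite diff_comp//= diff1E// -deriveE// Dz derive1E.
by have [_ ->] := hr z; rewrite E; exact: mulrC.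
Qed.

Lemma has_gradient_sum (k : nat) (phi : 'I_k -> T -> R) (g : 'I_k -> T -> 'rV[R]_n)
    (tau : 'I_k -> T -> R) : (forall i, has_gradient (phi i) (g i) (tau i)) ->
  has_gradient (fun z => \sum_i phi i z) (fun z => \sum_i g i z) (fun z => \sum_i tau i z).
Proof.
move=> hg; elim: k phi g tau hg => [|k IH] phi g tau hg.
  apply: has_gradient_ext (has_gradient_affine 0 0 0) _ _ _ => z; rewrite big_ord0//.
  by rewrite dot0l mul0r !addr0.
have := has_gradientD (IH _ _ _ (fun i => hg (widen_ord (leqnSn k) i))) (hg ord_max).
by move=> HG; apply: has_gradient_ext HG _ _ _ => z; rewrite big_ord_recr.
Qed.

Lemma is_derive_sqr (y : R) : is_derive y (1 : R) (fun y => y ^+ 2) (2 * y).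
Proof.
have := @is_deriveX R R id 2 y 1 1 (is_derive_id _ _).
by rewrite expr1 /GRing.scale/= mulr1.
Qed.

Lemma has_gradient_sqr_dist (x1 : 'rV[R]_n) :
  has_gradient (fun z => dot (z.1 - x1) (z.1 - x1)) (fun z => 2 *: (z.1 - x1)) (fun=> 0).
Proof.
have aff i := has_gradient_affine (delta_mx 0 i) 0 (- x1 0 i).
have sq i := has_gradient_comp (rho := fun y => y ^+ 2) (rho' := fun y => 2 * y) (aff i).
apply: has_gradient_ext (has_gradient_sum (fun i => sq i _ _)) _ _ _ => [i z|i z|z|z|z] /=.
- exact: is_derive_sqr.
- by move=> y; apply: cvgM; [exact: cvg_cst|exact: cvg_id].
- apply: eq_bigr => i _; rewrite mul0r addr0 dotC dot_delta expr2.
  by rewrite mxE mxE.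
- apply/rowP => k; rewrite summxE (bigD1 k)//= big1 => [|i /negbTE ik].
    by rewrite !mxE !eqxx mul0r !addr0 mulr1 dotC dot_delta.
  by rewrite !mxE eq_sym ik andbF mulr0.
- by rewrite big1// => i _; rewrite mulr0.
Qed.

Lemma has_gradient_dot_sqr (h x1 : 'rV[R]_n) :
  has_gradient (fun z => dot h (z.1 - x1) ^+ 2)
    (fun z => (2 * dot h (z.1 - x1)) *: h) (fun=> 0).
Proof.
have sq := has_gradient_comp (rho := fun y => y ^+ 2) (rho' := fun y => 2 * y)
  (has_gradient_affine h 0 (- dot h x1)).
apply: has_gradient_ext (sq _ _) _ _ _ => [z|z|z|z|z] /=.
- exact: is_derive_sqr.
- by move=> y; apply: cvgM; [exact: cvg_cst|exact: cvg_id].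
- by rewrite mul0r addr0 dotBr.
- by rewrite mul0r addr0 dotBr.
- by rewrite mulr0.
Qed.

Lemma has_gradient_time_sqr (t1 : R) :
  has_gradient (fun z => (z.2 - t1) ^+ 2) (fun=> 0) (fun z => 2 * (z.2 - t1)).
Proof.
have sq := has_gradient_comp (rho := fun y => y ^+ 2) (rho' := fun y => 2 * y)
  (has_gradient_affine 0 1 (- t1)).
apply: has_gradient_ext (sq _ _) _ _ _ => [z|z|z|z|z] /=.
- exact: is_derive_sqr.
- by move=> y; apply: cvgM; [exact: cvg_cst|exact: cvg_id].
- by rewrite dot0l add0r mul1r.
- by rewrite scaler0.
- by rewrite dot0l add0r mul1r mulr1.
Qed.

Lemma derive_le phi z h c : differentiable phi z ->
  (\forall s \near 0^'+, phi (s *: h + z) - phi z <= s * c) -> 'D_h phi z <= c.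
Proof.
move=> /(@diff_derivable _ _ _ _ _ h) dphi hc.
have : (fun s : R => s^-1 *: (phi (s *: h + z) - phi z)) @ (0 : R)^'+ --> 'D_h phi z.
  apply: cvg_trans dphi => A /=; rewrite !near_simpl /dnbhs /at_right !near_withinE.
  by apply: filterS => y hy y0; apply: hy; rewrite gt_eqF.
move=> /cvgr_to_le; apply; apply: filterS2 hc (nbhs_right_gt 0) => s hs s0.
by rewrite /GRing.scale/= mulrC ler_pdivrMr// mulrC.
Qed.

(** Competitors are only required to be replaceable by bounded points that are at least as good,
    which also covers functions invariant along unbounded directions. *)
Lemma coercive_max (u : T -> R) (z1 : T) (B : R) :
  {within closed_halfspace, continuous u} -> closed_halfspace z1 ->
  (forall z, closed_halfspace z -> u z1 <= u z ->
    exists2 z', closed_halfspace z' /\ `|z'| <= B & u z <= u z') ->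
  exists2 z0, closed_halfspace z0 & forall z, closed_halfspace z -> u z <= u z0.
Proof.
move=> cu hz1 hB.
pose K : set T := [set x | `|x| <= B] `*` `[0, B]%classic.
have cK : compact K.
  apply: compact_setX; last exact: segment_compact.
  apply: bounded_closed_compact; first by apply: (@norm_le_bounded_set _ _ _ B) => x.
  apply: (@preimage_closed _ _ (fun x : 'rV[R]_n => `|x|) [set y | y <= B]).
    by move=> x _; exact: norm_continuous.
  exact: closed_le.
have KT z : closed_halfspace z -> `|z| <= B -> K z.
  move=> hz; rewrite prod_normE ge_max => /andP[h1 h2]; split=> //=.
  by rewrite in_itv/= hz (le_trans (ler_norm _)).
have [z1' [hz1' z1'B] z1z1'] := hB z1 hz1 (lexx _).
have KH : K `<=` closed_halfspace by move=> z [_ /=]; rewrite in_itv/= => /andP[].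
have [|z0 z0K z0max] := @compact_EVT_max _ _ u K _ cK (continuous_subspaceW KH cu).
  by exists z1'; exact: KT.
rewrite inE in z0K; exists z0; first exact: KH.
have z0ge z : closed_halfspace z -> `|z| <= B -> u z <= u z0.
  by move=> hz zB; apply: z0max; rewrite inE; exact: KT.
move=> z hz; have [uz|/ltW uz] := leP (u z1) (u z).
  by have [z' [hz' z'B] /le_trans] := hB z hz uz; apply; exact: z0ge.
by rewrite (le_trans uz)// (le_trans z1z1')// z0ge.
Qed.

Lemma sqr_le_affine (C eta r : R) : 0 <= C -> 0 < eta -> 0 <= r ->
  eta * r ^+ 2 <= C * (1 + r) -> r <= 1 + 2 * C / eta.
Proof.
move=> C0 eta0 r0 h; rewrite leNgt; apply/negP => Br.
have r1 : 1 < r by apply: le_lt_trans Br; rewrite lerDl divr_ge0 ?mulr_ge0// ltW.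
have etar : 2 * C < eta * r.
  by rewrite [ltRHS]mulrC -ltr_pdivrMr//; apply: le_lt_trans Br; rewrite lerDr.
have : 2 * C * r < eta * r * r by rewrite ltr_pM2r// (lt_trans ltr01).
have : C * 1 <= C * r by rewrite ler_wpM2l// ltW.
by move: h; rewrite expr2 !mulrDr; lra.
Qed.

Lemma near_open_halfspace z : open_halfspace z -> \forall y \near z, open_halfspace y.
Proof. by move=> hz; apply: (@cvgr_gt _ _ _ _ (fun y : T => y.2) z.2 cvg_snd). Qed.

End Gradient.

(** * The maximum of affine functions is a solution *)

Lemma near_ray (R : realType) (V : normedModType R) (z h : V) (P : V -> Prop) :
  (\forall y \near z, P y) -> \forall s \near (0 : R)^'+, P (s *: h + z).
Proof.
move=> hP; have : (fun s : R => s *: h + z) @ (0 : R)^'+ --> z.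
  apply: cvg_at_right_filter; rewrite -[X in _ --> X]add0r -(scale0r h).
  by apply: cvgD; [apply: cvgZr_tmp; exact: cvg_id|exact: cvg_cst].
by apply.
Qed.

Section MaxAffine.
Context {R : realType} {m n : nat}.
Variables (p : 'I_m.+1 -> 'rV[R]_n) (theta gamma : 'I_m.+1 -> R).
Local Notation T := ('rV[R]_n * R)%type.
Local Notation neuron := (neuron p theta gamma).
Local Notation f := (f p theta gamma).
Implicit Types (alpha beta : 'rV[R]_m.+1) (z h : T).

Definition slope i h : R := dot (p i) h.1 - theta i * h.2.

Lemma le_f i x t : neuron i x t <= f (x, t).
Proof. exact: (le_max_ord (fun i => neuron i x t)). Qed.

Lemma f_activeP z : exists i, f z = neuron i z.1 z.2.
Proof. exact: (max_ordP (fun i => neuron i z.1 z.2)). Qed.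

Lemma f0 x : f (x, 0) = J p gamma x.
Proof. by congr max_ord; apply/funext => i; rewrite /= mul0r subr0. Qed.

Lemma le_J i x : dot (p i) x - gamma i <= J p gamma x.
Proof. exact: (le_max_ord (fun i => dot (p i) x - gamma i)). Qed.

Lemma neuron_ray i (s : R) h z :
  neuron i (s *: h + z).1 (s *: h + z).2 = s * slope i h + neuron i z.1 z.2.
Proof. by rewrite /neuron/slope/= dotDr dotZr /GRing.scale/=; ring. Qed.

Lemma f_lipschitz : exists2 K : R, 0 <= K & forall z z', `|f z - f z'| <= K * `|z - z'|.
Proof.
pose k i := n%:R * `|p i| + `|theta i|.
have k0 i : 0 <= k i by rewrite addr_ge0// mulr_ge0.
exists (\sum_i k i); first exact: sumr_ge0.
have neuron_lip i z z' : neuron i z.1 z.2 - neuron i z'.1 z'.2 <= (\sum_i k i) * `|z - z'|.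
  have -> : neuron i z.1 z.2 - neuron i z'.1 z'.2 =
      dot (p i) (z - z').1 - theta i * (z - z').2.
    by rewrite /neuron/= dotBr; ring.
  apply: (@le_trans _ _ (k i * `|z - z'|)); last first.
    by rewrite ler_wpM2r// (bigD1 i)//= lerDl sumr_ge0.
  rewrite prod_normE mulrDl lerD//.
    rewrite (le_trans (ler_norm _))// (le_trans (norm_dot_le _ _))//.
    by rewrite ler_wpM2l ?mulr_ge0// le_max lexx.
  rewrite (le_trans (ler_norm _))// normrN normrM ler_wpM2l//.
  by rewrite le_max lexx orbT.
have f_lip z z' : f z - f z' <= (\sum_i k i) * `|z - z'|.
  have [i ->] := f_activeP z; apply: le_trans (neuron_lip i z z').
  by rewrite lerD2l lerN2; case: z' => x t; exact: le_f.
by move=> z z'; rewrite ler_norml f_lip andbT lerNl opprB distrC.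
Qed.

Lemma f_uniformly_continuous : uniformly_continuous_on closed_halfspace f.
Proof.
have [K K0 fK] := f_lipschitz; move=> e e0; have K1 : 0 < K + 1 by exact: ltr_wpDl.
exists (e / (K + 1)) => [|z z' _ _]; first exact: divr_gt0.
rewrite ltr_pdivlMr// => h; apply: le_lt_trans h.
by rewrite (le_trans (fK _ _))// mulrC ler_wpM2l// lerDl.
Qed.

Lemma f_continuous : continuous f.
Proof.
have [K K0 fK] := f_lipschitz; move=> z; apply/cvgrPdist_lt => e e0.
have K1 : 0 < K + 1 by exact: ltr_wpDl.
have : \forall y \near z, `|z - y| < e / (K + 1).
  by apply: (@cvgr_dist_lt _ _ _ (nbhs z) _ id z); [exact: cvg_id|exact: divr_gt0].
apply: filterS => y; rewrite ltr_pdivlMr// => h; apply: le_lt_trans h.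
by rewrite (le_trans (fK _ _))// mulrC ler_wpM2l// lerDl.
Qed.

Lemma f_convex (D : set (convex_lmodType T)) : convex_function D f.
Proof.
move=> s y z _ _; have [i ->] := f_activeP (conv s y z).
have -> : neuron i (conv s y z).1 (conv s y z).2 =
    s%:inum * neuron i y.1 y.2 + (1 - s%:inum) * neuron i z.1 z.2.
  by rewrite /neuron/= dotDr !dotZr /unstable.onem /GRing.scale/=; ring.
rewrite [leRHS]convRE; apply: lerD; apply: ler_wpM2l.
- by [].
- by case: y => y t; exact: le_f.
- by rewrite subr_ge0.
- by case: z => y' t; exact: le_f.
Qed.

(** The neurons average to at least [f - kappa] under [alpha] and to at most [f] under [beta];
    subtracting isolates the excess in [theta]-cost. *)
Lemma active_le alpha beta q x t (kappa : R) : simplex alpha ->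
  f (x, t) - kappa <= cost (fun i => neuron i x t) alpha ->
  minimizers p gamma q beta ->
  t * (cost theta alpha - cost theta beta) <=
  kappa + dot (bary p alpha - q) x + (cost gamma beta - cost gamma alpha).
Proof.
move=> sa act [/feasibleP[sb bq] _].
have : cost (fun i => neuron i x t) beta <= f (x, t).
  by rewrite -(cost_const (f (x, t)) sb) le_cost// => i _; exact: le_f.
by move: act; rewrite !cost_neuron// bq dotBl; lra.
Qed.

(** An active neuron lies below [f] and touches it at [z0], so its slope is at most ['D_h phi z0] in
    every direction; opposite directions force equality. *)
Lemma f_subsolution (Ham : 'rV[R]_n -> \bar R) :
  (forall i, Ham (p i) = (theta i)%:E) -> viscosity_subsolution Ham f.
Proof.
move=> hH phi cphi z0 hz0 hmax; have [dphi _] := cphi z0 hz0.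
have [i fi] := f_activeP z0.
have ge h : slope i h <= 'D_h phi z0.
  rewrite -lerN2 -deriveN; last exact: diff_derivable.
  apply: derive_le; first exact: differentiableN.
  have := near_ray h hmax; apply: filterS => s; rewrite !fctE.
  have : neuron i (s *: h + z0).1 (s *: h + z0).2 <= f (s *: h + z0) by exact: le_f.
  by rewrite neuron_ray fi mulrN; lra.
have E h : 'D_h phi z0 = slope i h.
  apply/eqP; rewrite eq_le ge andbT -lerN2.
  have -> : - 'D_h phi z0 = 'D_(- h) phi z0 by rewrite !deriveE// linearN.
  apply: le_trans (ge _); rewrite /slope/= dotNr; lra.
have -> : grad_x phi z0 = p i.
  by apply/rowP => k; rewrite mxE E /slope/= dot_delta; ring.
rewrite hH /dt E /slope/= dot0r -EFinD lee_fin; lra.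
Qed.

(** If along some [h] every active slope were below ['D_h phi z0], then [f] would fall below its
    supporting test function; [conv_sep] turns this into weights. *)
Lemma supergradient_bary phi z0 : differentiable phi z0 ->
  local_min (fun z => f z - phi z) z0 ->
  exists alpha, [/\ simplex alpha, forall i, 0 < alpha 0 i -> neuron i z0.1 z0.2 = f z0 &
    forall h, 'D_h phi z0 = dot (bary p alpha) h.1 - cost theta alpha * h.2].
Proof.
move=> dphi hmin; pose act i := neuron i z0.1 z0.2 == f z0.
have [i0 /esym fi0] := f_activeP z0.
have lslope i : functional (slope i).
  by move=> c x y; rewrite /slope/= dotDr dotZr /GRing.scale/=; ring.
have lD : functional (fun h => 'D_h phi z0).
  by move=> c x y; rewrite !deriveE// linearP.
have [|alpha [sa aact aE]] := @conv_sep _ _ _ act slope _ lslope lD.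
  move=> h; apply: contrapT => no.
  (* [c] is the largest active slope; inactive indices receive the slope of the active neuron [i0]
     as a default. *)
  pose c := max_ord (fun i => if act i then slope i h else slope i0 h).
  have cD : c < 'D_h phi z0.
    rewrite /c; have [i ->] := max_ordP (fun i => if act i then slope i h else slope i0 h).
    rewrite ltNge; apply/negP => le; case: ifP le => [ai|_] le.
      by apply: no; exists i.
    by apply: no; exists i0 => //; exact/eqP.
  have cge i : act i -> slope i h <= c.
    move=> ai; have := le_max_ord (fun i => if act i then slope i h else slope i0 h) i.
    by rewrite ai.
  suff : 'D_h phi z0 <= c by rewrite leNgt cD.
  apply: derive_le => //.
  have small : \forall s \near (0 : R)^'+, forall i,
      neuron i (s *: h + z0).1 (s *: h + z0).2 <= f z0 + s * c.
    apply: filter_forall => i; have [ai|nai] := boolP (act i).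
      apply: filterS (nbhs_right_gt 0) => s s0; rewrite neuron_ray (eqP ai).
      by rewrite addrC lerD2l ler_wpM2l ?cge// ltW.
    (* An inactive neuron starts strictly below [f z0] and needs a positive time to catch up. *)
    pose gap := f z0 - neuron i z0.1 z0.2.
    have gap0 : 0 < gap.
      rewrite subr_gt0 lt_neqAle nai/=; case: (z0) => x t; exact: le_f.
    have D1 : 0 < `|slope i h - c| + 1 by rewrite ltr_wpDl.
    have /(@nbhs_right_lt R 0) : 0 < gap / (`|slope i h - c| + 1) by exact: divr_gt0.
    apply: filterS2 (nbhs_right_gt 0) => s s0; rewrite ltr_pdivlMr// neuron_ray => hs.
    have := ler_wpM2l (ltW s0) (ler_norm (slope i h - c)).
    by move: hs; rewrite /gap; nra.
  apply: filterS2 small (near_ray h hmin) => s hs hm.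
  have := (f_activeP (s *: h + z0)) => -[i fi].
  by have := hs i; rewrite -fi; lra.
exists alpha; split=> // [i /aact /eqP//|h].
rewrite (aE h) dot_bary /cost mulr_suml -sumrB; apply: eq_bigr => i _.
by rewrite /slope; ring.
Qed.

Lemma f_supersolution (Ham : 'rV[R]_n -> \bar R) :
  (forall q, q \in domJstar p gamma -> (H p theta gamma q <= Ham q)%E) ->
  viscosity_supersolution Ham f.
Proof.
move=> hH phi cphi z0 hz0 hmin; have [dphi _] := cphi z0 hz0.
have [alpha [sa act E]] := supergradient_bary dphi hmin.
have -> : grad_x phi z0 = bary p alpha.
  by apply/rowP => k; rewrite mxE E /= dot_delta; ring.
have qD : bary p alpha \in domJstar p gamma by apply/domJstarP; exists alpha.
rewrite /dt E /= dot0r mulr1 sub0r.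
have le : ((cost theta alpha)%:E <= H p theta gamma (bary p alpha))%E.
  apply: H_ge => beta bmin; case: z0 hz0 act {hmin dphi E} => x t /= t0 act.
  have fa : f (x, t) - 0 <= cost (fun i => neuron i x t) alpha.
    by rewrite subr0 -(cost_const (f (x, t)) sa) le_cost// => i /act ->.
  have := active_le sa fa bmin; rewrite subrr dot0l !add0r => h.
  have ga : cost gamma beta <= cost gamma alpha by apply: bmin.2; apply/feasibleP.
  by rewrite -subr_le0 -(pmulr_rle0 _ t0) (le_trans h)// subr_le0.
have := le_trans le (hH _ qD); case: (Ham _) => [r||//]; last by rewrite addey// leey.
by rewrite lee_fin -EFinD lee_fin; lra.
Qed.

End MaxAffine.

(** * Growth estimates and smooth barriers *)

Section Growth.
Context {R : realType} {n : nat}.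
Local Notation T := ('rV[R]_n * R)%type.

(** The segment between two points of the half-space is cut into pieces shorter than [d], each
    contributing at most one. *)
Lemma uniformly_continuous_growth (w : T -> R) :
  uniformly_continuous_on closed_halfspace w ->
  exists2 C : R, 0 < C & forall z z', closed_halfspace z -> closed_halfspace z' ->
    `|w z - w z'| <= C * (1 + `|z - z'|).
Proof.
move=> /(_ 1 ltr01)[d d0 wd].
have step (k : nat) z z' : closed_halfspace z -> closed_halfspace z' ->
    `|z - z'| < k.+1%:R * d -> `|w z - w z'| <= k.+1%:R.
  elim: k z z' => [|k IH] z z' hz hz' zz'.
    by apply/ltW/wd => //; rewrite mul1r in zz'.
  pose s : R := k.+2%:R^-1; pose y := z + s *: (z' - z).
  have k2 : 0 < k.+2%:R :> R by rewrite ltr0n.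
  have s0 : 0 < s by rewrite invr_gt0.
  have sk : s * k.+2%:R = 1 by rewrite mulVf// gt_eqF.
  have ks : 1 - s = s * k.+1%:R.
    by rewrite -{1}sk -[k.+2%:R]natr1 mulrDr mulr1 addrK.
  have hy : closed_halfspace y.
    have : y.2 = (1 - s) * z.2 + s * z'.2 by rewrite /y/= /GRing.scale/=; ring.
    rewrite /closed_halfspace/= => ->.
    by rewrite addr_ge0// mulr_ge0// ?ltW// ks mulr_gt0// ltr0n.
  have zy : `|z - y| < d.
    rewrite /y opprD addrA subrr add0r normrN normrZ gtr0_norm// distrC.
    by rewrite mulrC /s ltr_pdivrMr// [ltRHS]mulrC.
  have yz' : `|y - z'| < k.+1%:R * d.
    have -> : y - z' = (1 - s) *: (z - z').
      by rewrite /y scalerBl scale1r addrAC -(opprB z) scalerN.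
    rewrite normrZ gtr0_norm ?ks ?mulr_gt0 ?ltr0n//.
    rewrite -mulrA mulrCA ltr_pM2l ?ltr0n//.
    by rewrite mulrC /s ltr_pdivrMr// [ltRHS]mulrC.
  rewrite -(subrKA (w y)) (le_trans (ler_normD _ _))// -[k.+2]add1n natrD lerD//.
    exact/ltW/wd.
  exact: IH.
exists (1 + d^-1) => [|z z' hz hz']; first by rewrite addr_gt0// invr_gt0.
have q0 : 0 <= `|z - z'| / d by rewrite divr_ge0// ltW.
(* The number of pieces is one more than the integer part of the distance over [d], whence the
   constant [1 + d^-1]. *)
have /andP[le lt] := truncn_itv q0; rewrite ltr_pdivrMr// in lt.
apply: le_trans (step _ _ _ hz hz' lt) _.
rewrite -add1n natrD; have : 0 <= d^-1 by rewrite invr_ge0 ltW.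
by move: le (normr_ge0 (z - z')); rewrite mulrC; lra.
Qed.

End Growth.

(** * Log-sum-exp regularization of [f] *)

Section Softmax.
Context {R : realType} {m n : nat}.
Variables (p : 'I_m.+1 -> 'rV[R]_n) (theta gamma : 'I_m.+1 -> R).
Local Notation T := ('rV[R]_n * R)%type.
Local Notation neuron := (neuron p theta gamma).
Local Notation f := (f p theta gamma).

Definition softweight (eps : R) (z : T) (i : 'I_m.+1) : R :=
  expR (eps^-1 * neuron i z.1 z.2).

Definition logsumexp eps (z : T) : R := eps * ln (\sum_i softweight eps z i).

Definition softmax eps (z : T) : 'rV[R]_m.+1 :=
  \row_i ((\sum_j softweight eps z j)^-1 * softweight eps z i).

Lemma softweight_sum_gt0 eps z : 0 < \sum_i softweight eps z i.
Proof. by rewrite (bigD1 ord0)//= ltr_pwDl ?expR_gt0// sumr_ge0// => i _; exact: expR_ge0. Qed.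

Lemma softmax_simplex eps z : simplex (softmax eps z).
Proof.
apply/simplexP; split=> [i|].
  by rewrite mxE mulr_ge0 ?expR_ge0// invr_ge0 ltW// softweight_sum_gt0.
rewrite cost1; under eq_bigr do rewrite mxE.
by rewrite -mulr_sumr mulVf// gt_eqF// softweight_sum_gt0.
Qed.

Lemma f_le_logsumexp eps z : 0 < eps -> f z <= logsumexp eps z.
Proof.
move=> e0; have [i ->] := f_activeP p theta gamma z.
rewrite /logsumexp mulrC -ler_pdivrMr// mulrC -ler_expR lnK ?posrE ?softweight_sum_gt0//.
by rewrite (bigD1 i)//= lerDl sumr_ge0// => j _; exact: expR_ge0.
Qed.

(* Each weight is [exp (- u)] with [u = (logsumexp - neuron) / eps], and [u exp (- u) <= 1]. *)
Lemma logsumexp_le_cost eps z : 0 < eps ->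
  logsumexp eps z - eps * m.+1%:R <= cost (fun i => neuron i z.1 z.2) (softmax eps z).
Proof.
move=> e0; set F := logsumexp eps z.
have wE i : softmax eps z 0 i = expR (- ((F - neuron i z.1 z.2) / eps)).
  rewrite mxE -mulNr opprB mulrBl expRB mulrC; congr (_ / _).
    by rewrite /softweight mulrC.
  by rewrite /F /logsumexp mulrC mulKf ?gt_eqF// lnK// posrE softweight_sum_gt0.
rewrite lerBlDr -lerBlDl -{1}(cost_const F (softmax_simplex eps z)) /cost -sumrB.
rewrite -[m.+1 in leRHS]card_ord mulr_natr -sumr_const ler_sum// => i _.
rewrite -mulrBr wE; set u := (F - _) / eps.
have -> : F - neuron i z.1 z.2 = eps * u by rewrite mulrC divfK// gt_eqF.
rewrite mulrCA -[leRHS]mulr1 ler_wpM2l ?(ltW e0)// expRN mulrC ler_pdivrMr ?expR_gt0// mul1r.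
by apply: le_trans (expR_ge1Dx u); rewrite lerDr.
Qed.

Lemma logsumexp_le_f eps z : 0 < eps -> logsumexp eps z <= f z + eps * m.+1%:R.
Proof.
move=> e0; rewrite -lerBlDr (le_trans (logsumexp_le_cost z e0))//.
rewrite -(cost_const (f z) (softmax_simplex eps z)) le_cost//; first exact: softmax_simplex.
by case: z => x t i _; exact: le_f.
Qed.

Lemma has_gradient_logsumexp eps : 0 < eps ->
  has_gradient (logsumexp eps) (fun z => bary p (softmax eps z))
    (fun z => - cost theta (softmax eps z)).
Proof.
move=> e0.
have aff i := has_gradientZ eps^-1 (has_gradient_affine (p i) (- theta i) (- gamma i)).
have ex i := has_gradient_comp (aff i) (fun z => is_derive_expR _)
  (fun z => @continuous_expR _ _).
have E z : \sum_i expR (eps^-1 * (dot (p i) z.1 + - theta i * z.2 + - gamma i)) =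
    \sum_i softweight eps z i.
  by apply: eq_bigr => i _; rewrite /softweight/neuron; congr (expR (_ * _)); ring.
have sm : has_gradient (fun z => \sum_i softweight eps z i) _ _ :=
  has_gradient_ext (has_gradient_sum ex) E (fun=> erefl) (fun=> erefl).
have := has_gradientZ eps (has_gradient_comp (rho := @ln R) (rho' := fun y => y^-1) sm _ _).
move=> /(_ (fun z => is_derive1_ln (softweight_sum_gt0 eps z))).
move=> /(_ (fun z => inv_continuous (lt0r_neq0 (softweight_sum_gt0 eps z)))) HG.
have wE i z : expR (eps^-1 * (dot (p i) z.1 + - theta i * z.2 + - gamma i)) =
    softweight eps z i.
  by rewrite /softweight/neuron; congr (expR (_ * _)); ring.
apply: has_gradient_ext HG _ _ _ => z //.
  rewrite /bary !scaler_sumr; apply: eq_bigr => i _; rewrite wE mxE !scalerA.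
  by congr (_ *: _); field; rewrite !gt_eqF ?softweight_sum_gt0.
rewrite /cost !mulr_sumr -sumrN; apply: eq_bigr => i _; rewrite wE mxE.
by field; rewrite !gt_eqF ?softweight_sum_gt0.
Qed.

End Softmax.

(** * Comparison *)

Section Penalization.
Context {R : realType} {n : nat}.
Local Notation T := ('rV[R]_n * R)%type.
Implicit Types (u phi : T -> R) (z : T) (eta rho : R).

(** The linear term in time makes the viscosity inequality strict by at least [eta]; the square
    gives coercivity in time. *)
Definition penalty rho eta z : R := rho * dot z.1 z.1 + eta * (z.2 + z.2 ^+ 2).

Lemma has_gradient_penalty rho eta : has_gradient (penalty rho eta)
  (fun z => (2 * rho) *: z.1) (fun z => eta * (1 + 2 * z.2)).
Proof.
have HG := has_gradientD (has_gradientZ rho (@has_gradient_sqr_dist R n 0))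
  (has_gradientZ eta (has_gradientD (has_gradient_affine 0 1 0) (has_gradient_time_sqr 0))).
apply: has_gradient_ext HG _ _ _ => z; rewrite ?subr0.
- by rewrite dot0l mul1r add0r addr0.
- by rewrite scalerA addr0 scaler0 addr0 mulrC.
- by rewrite mulr0 add0r.
Qed.

Lemma continuous_withinB (u phi : T -> R) (A : set T) :
  {within A, continuous u} -> continuous phi -> {within A, continuous (fun z => u z - phi z)}.
Proof.
move=> cu cphi; have cp : {within A, continuous phi} by exact: continuous_subspaceT.
by move=> z; apply: (@cvgB R^o); [exact: cu|exact: cp].
Qed.

(* The penalty [rho |x|^2] is made so small that its gradient [2 rho x] is at most
   [delta] at the maximum point, which is possible because [rho |x|^2] stays
   bounded there independently of [rho]. *)
Lemma penalized_max u z1 (C eta a delta : R) :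
  {within closed_halfspace, continuous u} ->
  0 <= C -> 0 < eta -> 0 < a -> 0 < delta ->
  (forall z, closed_halfspace z -> u z <= C * (1 + z.2)) ->
  closed_halfspace z1 -> a + eta * (z1.2 + z1.2 ^+ 2) <= u z1 ->
  exists rho z0, [/\ closed_halfspace z0, `|(2 * rho) *: z0.1| <= delta,
    0 <= dot ((2 * rho) *: z0.1) z0.1, rho * dot z1.1 z1.1 <= a &
    forall z, closed_halfspace z -> u z - penalty rho eta z <= u z0 - penalty rho eta z0].
Proof.
move=> cu C0 eta0 a0 d0 uC hz1 uz1.
(* On points where the penalized function is nonnegative, [B] bounds the time and [C1] bounds
   [rho * dot z.1 z.1]. *)
pose B := 1 + 2 * C / eta; pose C1 := C * (1 + B).
have B0 : 0 <= B by rewrite addr_ge0// divr_ge0 ?mulr_ge0// ltW.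
have C10 : 0 <= C1 by rewrite mulr_ge0// addr_ge0.
pose S := dot z1.1 z1.1.
have S0 : 0 <= S by exact: dotxx_ge0.
(* The first condition keeps the spatial penalty at [z1] below [a]; the second gives
   [4 * rho * C1 <= delta ^+ 2], the bound for the squared gradient. *)
have [|rho rho0 [rhoS rhoC]] := @near_right0_ex R (fun rho => rho * (S + 1) < a /\
    rho * (4 * C1 + 1) < delta ^+ 2).
  have sm (b c : R) : 0 <= b -> 0 < c -> \forall r \near (0 : R)^'+, r * (b + 1) < c.
    move=> b0 c0; have b1 : 0 < b + 1 by rewrite ltr_wpDl.
    have /(@nbhs_right_lt R 0) : 0 < c / (b + 1) by exact: divr_gt0.
    by apply: filterS => r; rewrite ltr_pdivlMr.
  near=> r; split; near: r; apply: sm => //; last by rewrite exprn_gt0.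
  by rewrite mulr_ge0.
have bound z : closed_halfspace z -> 0 <= u z - penalty rho eta z ->
    z.2 <= B /\ rho * dot z.1 z.1 <= C1.
  move=> hz; have z20 : 0 <= z.2 := hz; have := uC z hz.
  rewrite /penalty => uz pz.
  have q0 : 0 <= rho * dot z.1 z.1 by rewrite mulr_ge0 ?dotxx_ge0// ltW.
  have zB : z.2 <= B.
    apply: sqr_le_affine => //.
    by have := mulr_ge0 (ltW eta0) z20; move: uz pz q0; rewrite mulrDr; lra.
  split=> //; apply: (@le_trans _ _ (C * (1 + z.2))).
    have : 0 <= eta * (z.2 + z.2 ^+ 2) by rewrite mulr_ge0 ?addr_ge0 ?exprn_ge0// ltW.
    by move: uz pz; lra.
  by rewrite ler_wpM2l// lerD2l.
have uz10 : 0 <= u z1 - penalty rho eta z1.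
  by move: rhoS uz1; rewrite /penalty -/S mulrDr mulr1; lra.
have [||z0 hz0 z0max] := @coercive_max _ _ (fun z => u z - penalty rho eta z) z1
    (1 + C1 / rho + B) _ hz1.
- apply: continuous_withinB => //; exact: (has_gradient_continuous (has_gradient_penalty _ _)).
- move=> z hz uz; exists z => //; split=> //.
  have [zB zC] := bound z hz (le_trans uz10 uz).
  have q0 : 0 <= C1 / rho by rewrite divr_ge0// ltW.
  rewrite prod_normE ge_max; apply/andP; split; last first.
    by rewrite ger0_norm//; apply: (le_trans zB); rewrite lerDr addr_ge0.
  apply: norm_le_dot; first by apply: addr_ge0 => //; exact: addr_ge0.
  have : dot z.1 z.1 <= C1 / rho by rewrite ler_pdivlMr// mulrC.
  by move=> /le_trans; apply; rewrite expr2; nra.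
have [zB zC] := bound z0 hz0 (le_trans uz10 (z0max _ hz1)).
exists rho, z0; split=> //.
- apply: norm_le_dot; first exact: ltW.
  rewrite dotZl dotZr; apply: (@le_trans _ _ (4 * rho * C1)).
    have -> : 2 * rho * (2 * rho * dot z0.1 z0.1) = 4 * rho * (rho * dot z0.1 z0.1) by ring.
    by rewrite ler_wpM2l// mulr_ge0// ltW.
  by move: rhoC; rewrite mulrDr; lra.
- by rewrite dotZl mulr_ge0 ?dotxx_ge0// mulr_ge0// ltW.
- by rewrite -/S; move: rhoS rho0; rewrite mulrDr mulr1; lra.
Unshelve. all: by end_near. Qed.

End Penalization.

(** * Comparison of [f] with subsolutions and supersolutions *)

Section Comparison.
Context {R : realType} {m n : nat}.
Variables (p : 'I_m.+1 -> 'rV[R]_n) (theta gamma : 'I_m.+1 -> R).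
Local Notation T := ('rV[R]_n * R)%type.
Local Notation neuron := (neuron p theta gamma).
Local Notation f := (f p theta gamma).
Variables (Ham : 'rV[R]_n -> \bar R) (w : T -> R).
Hypotheses (cw : {within closed_halfspace, continuous w})
  (w0 : forall x, w (x, 0) = J p gamma x)
  (ucw : uniformly_continuous_on closed_halfspace w).

(** Both functions equal [J] at time zero, so only the vertical segment below [(x, t)] enters and
    the bound is uniform in [x]. *)
Lemma solution_growth : exists2 C : R, 0 <= C &
  forall z, closed_halfspace z -> `|w z - f z| <= C * (1 + z.2).
Proof.
have [C C0 wC] := uniformly_continuous_growth ucw.
have [K K0 fK] := f_lipschitz p theta gamma.
exists (C + K) => [|[x t] /= t0]; first by rewrite addr_ge0// ltW.
have h0 : closed_halfspace (x, 0 : R) by rewrite /closed_halfspace/=.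
have nE : `|(x, t) - (x, 0)| = t.
  by rewrite prod_normE/= subrr normr0 subr0 max_r ?ger0_norm.
have -> : w (x, t) - f (x, t) = (w (x, t) - w (x, 0)) - (f (x, t) - f (x, 0)).
  by rewrite w0 f0; ring.
rewrite (le_trans (ler_normB _ _))// mulrDl lerD//.
  by have := wC _ _ t0 h0; rewrite nE.
by rewrite (le_trans (fK _ _))// nE ler_wpM2l// lerDr.
Qed.

Lemma initial_layer (a : R) : 0 < a -> exists2 tau : R, 0 < tau &
  forall z, closed_halfspace z -> z.2 <= tau -> w z - f z <= a.
Proof.
move=> a0; have a2 : 0 < a / 2 by exact: divr_gt0.
have [d d0 wd] := ucw a2; have [d' d0' fd] := f_uniformly_continuous p theta gamma a2.
exists (Num.min d d' / 2) => [|[x t] /= t0 tm]; first by rewrite divr_gt0// lt_min d0.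
have h0 : closed_halfspace (x, 0 : R) by rewrite /closed_halfspace/=.
have nE : `|(x, t) - (x, 0)| = t.
  by rewrite prod_normE/= subrr normr0 subr0 max_r ?ger0_norm.
have tm' : t < Num.min d d'.
  by apply: le_lt_trans tm _; rewrite ltr_pdivrMr// ltr_pMr ?lt_min ?d0// ltr1n.
move: tm'; rewrite lt_min => /andP[td td'].
have := wd _ _ t0 h0; have := fd _ _ t0 h0; rewrite nE w0 f0 => /(_ td')/ltW.
rewrite ler_norml => /andP[f1 f2] /(_ td)/ltW; rewrite ler_norml => /andP[w1 w2].
by move: a2 f1 f2 w1 w2; lra.
Qed.

(* The test function is [logsumexp] plus a small penalty: its spatial gradient is
   a convex combination of the [p i] whose weights are almost active, up to an
   error [r] pointing in the direction of [x]. *)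
Lemma comparison_upper : viscosity_subsolution Ham w ->
  (forall e tau : R, 0 < e -> 0 < tau -> exists2 kappa : R, 0 < kappa &
    exists2 delta : R, 0 < delta & forall x t (alpha : 'rV[R]_m.+1) r,
    tau <= t -> simplex alpha ->
    f (x, t) - kappa <= cost (fun i => neuron i x t) alpha ->
    `|r| <= delta -> 0 <= dot r x ->
    ((cost theta alpha - e)%:E <= Ham (bary p alpha + r))%E) ->
  forall z, closed_halfspace z -> w z <= f z.
Proof.
move=> subw hHam z1 hz1; rewrite leNgt; apply/negP => fw.
have t10 : 0 <= z1.2 := hz1.
(* The gap [5 * a] pays one [a] each for the log-sum-exp error, the spatial penalty, the time
   penalty and the initial layer, and keeps one as margin. *)
pose a := (w z1 - f z1) / 5; have a0 : 0 < a by rewrite divr_gt0// subr_gt0.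
have [tau tau0 htau] := initial_layer a0.
pose eta := a / (1 + z1.2 + z1.2 ^+ 2).
have d1 : 0 < 1 + z1.2 + z1.2 ^+ 2 by rewrite -addrA ltr_pwDl// addr_ge0// exprn_ge0.
have eta0 : 0 < eta by exact: divr_gt0.
have etaa : eta * (z1.2 + z1.2 ^+ 2) <= a.
  have : eta * (1 + z1.2 + z1.2 ^+ 2) = a by rewrite divfK// gt_eqF.
  by rewrite !mulrDr; move: eta0; lra.
have [kappa k0 [delta delta0 hk]] := hHam eta tau eta0 tau0.
have M0 : 0 < m.+1%:R :> R by rewrite ltr0n.
(* The log-sum-exp error [eps * m.+1%:R] must be at most [kappa], for almost activity, and at most
   [a]. *)
pose eps := Num.min kappa a / m.+1%:R.
have eps0 : 0 < eps by rewrite divr_gt0// lt_min k0.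
have epsM : eps * m.+1%:R = Num.min kappa a by rewrite divfK// gt_eqF.
have epsk : eps * m.+1%:R <= kappa by rewrite epsM ge_min lexx.
have epsa : eps * m.+1%:R <= a by rewrite epsM ge_min lexx orbT.
pose F := logsumexp p theta gamma eps.
have fF z : f z <= F z by exact: f_le_logsumexp.
have HF := has_gradient_logsumexp p theta gamma eps0.
have [C C0 wfC] := solution_growth.
have [|||rho [z0 [hz0 r1 r2 rz1 z0max]]] := @penalized_max _ _ (fun z => w z - F z) z1 C eta a
    delta _ C0 eta0 a0 delta0 _ hz1.
- by apply: continuous_withinB => //; exact: (has_gradient_continuous HF).
- move=> z hz; apply: le_trans (wfC z hz); apply: le_trans (ler_norm _).
  by rewrite lerD2l lerN2.
- have := logsumexp_le_f p theta gamma z1 eps0; rewrite -/F.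
  have : w z1 - f z1 = 5 * a by rewrite mulrC divfK.
  by move: etaa epsa a0; lra.
(* The maximum lies outside the initial layer, where the assumption on [Ham] is available. *)
have t0tau : tau < z0.2.
  rewrite ltNge; apply/negP => le; have := htau _ hz0 le; have := fF z0.
  have := z0max _ hz1; rewrite /penalty.
  have : 0 <= rho * dot z0.1 z0.1.
    by move: r2; rewrite dotZl -mulrA pmulr_rge0.
  have : 0 <= eta * (z0.2 + z0.2 ^+ 2).
    by rewrite mulr_ge0 ?addr_ge0 ?exprn_ge0// ltW.
  have := logsumexp_le_f p theta gamma z1 eps0; rewrite -/F.
  have : w z1 - f z1 = 5 * a by rewrite mulrC divfK.
  by move: etaa epsa a0 rz1; lra.
have z0op : open_halfspace z0 by exact: lt_trans t0tau.
have Hphi := has_gradientD HF (has_gradient_penalty rho eta).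
have lmax : local_max (fun z => w z - (F z + penalty rho eta z)) z0.
  have := near_open_halfspace z0op; apply: filterS => z /ltW hz.
  by have := z0max z hz; lra.
have := subw _ (has_gradient_C1 Hphi) z0 z0op lmax.
rewrite (has_gradient_dt _ Hphi) (has_gradient_grad_x _ Hphi).
have act : f (z0.1, z0.2) - kappa <=
    cost (fun i => neuron i z0.1 z0.2) (softmax p theta gamma eps z0).
  have := logsumexp_le_cost p theta gamma z0 eps0; apply: le_trans.
  by rewrite -/F -surjective_pairing; have := fF z0; move: epsk; lra.
have := hk _ _ _ _ (ltW t0tau) (softmax_simplex _ _ _ _ _) act r1 r2.
case: (Ham _) => [r||]; [rewrite -EFinD !lee_fin|by rewrite addey|by rewrite leeNy_eq].
(* The time penalty contributes [eta * (1 + 2 * t)], while the assumption on [Ham] with [e = eta]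
   loses only [eta]. *)
by have := mulr_gt0 eta0 z0op; lra.
Qed.

(** Since [f] is a maximum, each neuron can be compared separately; perturbing its gradient requires
    [Ham] to be nearly at most [theta i] on a whole neighbourhood of [p i]. *)
Lemma comparison_lower : viscosity_supersolution Ham w ->
  (forall i (e : R), 0 < e -> exists2 delta : R, 0 < delta &
    forall r, `|r| <= delta -> (Ham (p i + r)%R <= (theta i + e)%:E)%E) ->
  forall z, closed_halfspace z -> f z <= w z.
Proof.
move=> supw hHam z1 hz1; have [i ->] := f_activeP p theta gamma z1.
rewrite leNgt; apply/negP => fw; have t10 : 0 <= z1.2 := hz1.
pose a := (neuron i z1.1 z1.2 - w z1) / 3.
have a0 : 0 < a by rewrite divr_gt0// subr_gt0.
pose eta := a / (1 + z1.2 + z1.2 ^+ 2).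
have d1 : 0 < 1 + z1.2 + z1.2 ^+ 2 by rewrite -addrA ltr_pwDl// addr_ge0// exprn_ge0.
have eta0 : 0 < eta by exact: divr_gt0.
have etaa : eta * (z1.2 + z1.2 ^+ 2) <= a.
  have : eta * (1 + z1.2 + z1.2 ^+ 2) = a by rewrite divfK// gt_eqF.
  by rewrite !mulrDr; move: eta0; lra.
have [delta delta0 hd] := hHam i eta eta0.
have HL := has_gradient_affine (p i) (- theta i) (- gamma i).
have LE z : dot (p i) z.1 + - theta i * z.2 + - gamma i = neuron i z.1 z.2.
  by rewrite /neuron; ring.
have [C C0 wfC] := solution_growth.
have [|||rho [z0 [hz0 r1 r2 rz1 z0max]]] := @penalized_max _ _
    (fun z => - (w z - (dot (p i) z.1 + - theta i * z.2 + - gamma i))) z1 C eta a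
    delta _ C0 eta0 a0 delta0 _ hz1.
- have cu : {within closed_halfspace, continuous
      (fun z => w z - (dot (p i) z.1 + - theta i * z.2 + - gamma i))}.
    by apply: continuous_withinB => //; exact: (has_gradient_continuous HL).
  by move=> z; apply: (@cvgN R^o); exact: cu.
- move=> z hz; apply: le_trans (wfC z hz); rewrite LE distrC opprB.
  apply: le_trans (ler_norm _); rewrite lerD2r; case: z {hz} => x t; exact: le_f.
- rewrite LE; have : neuron i z1.1 z1.2 - w z1 = 3 * a by rewrite mulrC divfK.
  by move: etaa a0; lra.
have := z0max z1 hz1; rewrite !LE => z0z1.
have pz0 : 0 <= penalty rho eta z0.
  apply: addr_ge0; first by move: r2; rewrite dotZl -mulrA pmulr_rge0.
  by apply: mulr_ge0; [exact: ltW|rewrite addr_ge0// exprn_ge0].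
have uz0 : w z0 < neuron i z0.1 z0.2.
  have : neuron i z1.1 z1.2 - w z1 = 3 * a by rewrite mulrC divfK.
  by move: z0z1; rewrite {1}/penalty; move: etaa a0 rz1; lra.
have z0op : open_halfspace z0.
  rewrite /open_halfspace/= lt_neqAle; apply/andP; split=> //; apply/eqP => t0.
  move: uz0; rewrite ltNge; apply/negP/negPn.
  case: z0 t0 {r1 r2 hz0 z0max z0z1 pz0} => x t /= <-.
  by rewrite w0 /neuron mul0r subr0; exact: le_J.
have Hphi := has_gradientD HL (has_gradientZ (-1) (has_gradient_penalty rho eta)).
have lmin : local_min (fun z => w z - (dot (p i) z.1 + - theta i * z.2 + - gamma i +
    -1 * penalty rho eta z)) z0.
  have := near_open_halfspace z0op; apply: filterS => z /ltW hz.
  by have := z0max z hz; lra.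
have := supw _ (has_gradient_C1 Hphi) z0 z0op lmin.
rewrite (has_gradient_dt _ Hphi) (has_gradient_grad_x _ Hphi).
have := hd (-1 *: ((2 * rho) *: z0.1)); rewrite {1}scaleN1r normrN => /(_ r1).
case: (Ham _) => [r||]; [rewrite -EFinD !lee_fin|by rewrite leye_eq|by rewrite addeNy].
by have := mulr_gt0 eta0 z0op; lra.
Qed.

End Comparison.

(** * Directions along which subsolutions are affine *)

Section NullDirection.
Context {R : realType} {n : nat}.
Local Notation T := ('rV[R]_n * R)%type.

(* A maximum point of [w] minus an anisotropic parabola, steep except along [h],
   must lie on the hyperplane orthogonal to [h] through the centre [(x1, t1)]. *)
Lemma null_direction_le (w : T -> R) (h pb x1 : 'rV[R]_n) (t1 : R) :
  {within closed_halfspace, continuous w} ->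
  uniformly_continuous_on closed_halfspace w ->
  (forall phi, C1 phi -> forall z, open_halfspace z ->
     local_max (fun z => w z - phi z) z -> dot h (grad_x phi z) = dot h pb) ->
  0 < t1 -> w (x1 + h, t1) <= w (x1, t1) + dot h pb.
Proof.
move=> cw ucw hgrad t10.
have [->|h0] := eqVneq h 0; first by rewrite addr0 dot0l addr0.
have d0 : 0 < dot h h.
  by rewrite lt_neqAle dotxx_ge0 andbT eq_sym; apply: contra_neq h0; exact: dotxx_eq0.
rewrite leNgt; apply/negP => hlt.
pose d := dot h h; pose z1 : T := (x1, t1).
pose v (z : T) := w z - dot pb z.1.
(* [v] should not increase from [x1] to [x1 + h]; [g] is the supposed increase. *)
pose g := v (x1 + h, t1) - v z1.
have g0 : 0 < g.
  by rewrite /g/v/= dotDr (dotC pb h); move: hlt; lra.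
have hz1 : closed_halfspace z1 by exact: ltW.
have [C [C0 vC]] : exists C, 0 < C /\
    forall z, closed_halfspace z -> v z - v z1 <= C * (1 + `|z - z1|).
  have [C C0 wC] := uniformly_continuous_growth ucw.
  exists (C + n%:R * `|pb|); split=> [|z hz]; first by rewrite ltr_pwDl// mulr_ge0.
  have -> : v z - v z1 = (w z - w z1) - dot pb (z.1 - x1) by rewrite /v dotBr/=; ring.
  rewrite (le_trans (ler_norm _))// (le_trans (ler_normB _ _))// mulrDl lerD//.
    exact: wC.
  rewrite (le_trans (norm_dot_le _ _))// ler_wpM2l ?mulr_ge0//.
  by rewrite (@le_trans _ _ `|z - z1|)// ?lerDr// prod_normE le_max lexx.
have [r [r0 vr]] : exists r, 0 < r /\
    forall z, closed_halfspace z -> `|z - z1| < r -> v z - v z1 <= g / 2.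
  have g4 : 0 < g / 4 by exact: divr_gt0.
  have [r r0 wr] := ucw _ g4.
  have q0 : 0 < n%:R * `|pb| + 1 by rewrite ltr_wpDl// mulr_ge0.
  exists (Num.min r (g / 4 / (n%:R * `|pb| + 1))); split.
    by rewrite lt_min r0 divr_gt0.
  move=> z hz; rewrite lt_min => /andP[zr]; rewrite ltr_pdivlMr// => zr'.
  have -> : v z - v z1 = (w z - w z1) - dot pb (z.1 - x1) by rewrite /v dotBr/=; ring.
  have := wr z z1 hz hz1 zr; move=> /ltW; rewrite ler_norml => /andP[_ le1].
  have : - dot pb (z.1 - x1) <= g / 4.
    rewrite (le_trans (ler_norm _))// normrN (le_trans (norm_dot_le _ _))//.
    apply: le_trans (ltW zr'); rewrite [leRHS]mulrC; apply: ler_pM => //.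
    - by rewrite lerDl.
    - by rewrite prod_normE le_max lexx.
  by move: le1; lra.
pose rho := Num.min (Num.min r t1) 1.
have rho0 : 0 < rho by rewrite !lt_min r0 t10 ltr01.
have rhor : rho <= r by rewrite /rho !ge_min lexx.
have rho1 : rho <= 1 by rewrite /rho ge_min lexx orbT.
(* The parabola is worth [mu] at [x1 + h], with coefficient [kap] along [h] and [K] across. [K] is
   taken large enough to confine the maximum to positive times and, once it is orthogonal to [h], to
   distance [rho]. *)
pose mu := g / 4; have mu0 : 0 < mu by exact: divr_gt0.
pose kap := mu / d; have kap0 : 0 < kap by exact: divr_gt0.
pose B := 1 + 2 * C / kap.
have B0 : 0 < B by rewrite addr_gt0// divr_gt0// mulr_gt0.
pose K := kap + 2 * C / rho ^+ 2 + C * (1 + B) / t1 ^+ 2 + 1.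
have e1 : 0 < 2 * C / rho ^+ 2 by rewrite divr_gt0 ?exprn_gt0// mulr_gt0.
have e2 : 0 < C * (1 + B) / t1 ^+ 2.
  by rewrite divr_gt0 ?exprn_gt0// mulr_gt0// addr_gt0.
have K1 : kap < K by rewrite /K; move: e1 e2; lra.
have K2 : 2 * C < K * rho ^+ 2.
  by rewrite -ltr_pdivrMr ?exprn_gt0// /K; move: kap0 e1 e2; lra.
have K3 : C * (1 + B) < K * t1 ^+ 2.
  by rewrite -ltr_pdivrMr ?exprn_gt0// /K; move: kap0 e1 e2; lra.
have K0 : 0 < K by exact: lt_trans K1.
pose cc := (K - kap) / d.
pose psi (z : T) := K * dot (z.1 - x1) (z.1 - x1) + - cc * dot h (z.1 - x1) ^+ 2 +
  K * (z.2 - t1) ^+ 2.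
have Hpsi : has_gradient (fun z => psi z + (dot pb z.1 + 0 * z.2 + 0)) _ _ :=
  has_gradientD (has_gradientD (has_gradientD (has_gradientZ K (has_gradient_sqr_dist x1))
    (has_gradientZ (- cc) (has_gradient_dot_sqr h x1)))
    (has_gradientZ K (has_gradient_time_sqr t1))) (has_gradient_affine pb 0 0).
have psiE z : v z - psi z = w z - (psi z + (dot pb z.1 + 0 * z.2 + 0)).
  by rewrite /v; ring.
have psi_h : psi (x1 + h, t1) = mu.
  rewrite /psi/= [x1 + h]addrC addrK subrr expr0n/= mulr0 addr0 -/d /cc /kap.
  by field; rewrite gt_eqF.
have psi_ge z : kap * dot (z.1 - x1) (z.1 - x1) + K * (z.2 - t1) ^+ 2 <= psi z.
  rewrite /psi lerD2r; move: (z.1 - x1) => y.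
  (* Cauchy-Schwarz, written as the squared length of the component orthogonal to [h]. *)
  have CS : 0 <= dot y y - dot h y ^+ 2 / d.
    have -> : dot y y - dot h y ^+ 2 / d =
        dot (y - (dot h y / d) *: h) (y - (dot h y / d) *: h).
      by rewrite !dotBr !dotBl !dotZl !dotZr (dotC y h) -/d; field; rewrite gt_eqF.
    exact: dotxx_ge0.
  have : 0 <= (K - kap) * (dot y y - dot h y ^+ 2 / d) by rewrite mulr_ge0// subr_ge0 ltW.
  have -> : (K - kap) * (dot y y - dot h y ^+ 2 / d) =
      (K - kap) * dot y y - cc * dot h y ^+ 2 by rewrite /cc; ring.
  by lra.
have sq_norm (z : T) : `|z - z1| ^+ 2 <= dot (z.1 - x1) (z.1 - x1) + (z.2 - t1) ^+ 2.
  rewrite prod_normE/=; have q1 := dotxx_ge0 (z.1 - x1); have q2 := sqr_ge0 (z.2 - t1).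
  have [_|_] := leP `|z.1 - x1| `|z.2 - t1|.
    by rewrite real_normK ?num_real// lerDr.
  by apply: (le_trans (sqr_norm_le_dot _)); rewrite lerDl.
have bound z : closed_halfspace z -> v (x1 + h, t1) - psi (x1 + h, t1) <= v z - psi z ->
    psi z <= C * (1 + `|z - z1|) /\ `|z - z1| <= B.
  move=> hz le; have psiC : psi z <= C * (1 + `|z - z1|).
    apply: le_trans (vC z hz); move: le; rewrite psi_h.
    have : v (x1 + h, t1) = v z1 + g by rewrite /g; ring.
    have : mu <= g by rewrite /mu; move: g0; lra.
    by lra.
  split=> //; apply: sqr_le_affine => //; first exact: ltW.
  apply: le_trans psiC; apply: le_trans (psi_ge z).
  apply: (@le_trans _ _ (kap * (dot (z.1 - x1) (z.1 - x1) + (z.2 - t1) ^+ 2))).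
    by rewrite ler_wpM2l// ltW.
  by rewrite mulrDr lerD2l ler_wpM2r ?sqr_ge0// ltW.
have hzh : closed_halfspace (x1 + h, t1) by exact: ltW.
have [||z0 hz0 z0max] := @coercive_max _ _ (fun z => v z - psi z) _ (`|z1| + B) _ hzh.
- have -> : (fun z => v z - psi z) = fun z => w z - (psi z + (dot pb z.1 + 0 * z.2 + 0)).
    exact/funext.
  exact: (continuous_withinB cw (has_gradient_continuous Hpsi)).
- move=> z hz le; exists z => //; split=> //; have [_ zB] := bound z hz le.
  by rewrite -{1}(subrK z1 z) [leRHS]addrC (le_trans (ler_normD _ _))// lerD2r.
have [psiC zB] := bound z0 hz0 (z0max _ hzh).
have q1 := dotxx_ge0 (z0.1 - x1).
have z0op : open_halfspace z0.
  rewrite /open_halfspace/= lt_neqAle; apply/andP; split=> //; apply/eqP => t0.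
  have : K * t1 ^+ 2 <= C * (1 + B).
    apply: le_trans (_ : C * (1 + `|z0 - z1|) <= _); last by rewrite ler_pM2l// lerD2l.
    apply: le_trans psiC; apply: le_trans (psi_ge z0).
    by rewrite -t0 sub0r sqrrN lerDr mulr_ge0// ltW.
  by rewrite leNgt K3.
have lmax : local_max (fun z => w z - (psi z + (dot pb z.1 + 0 * z.2 + 0))) z0.
  have := near_open_halfspace z0op; apply: filterS => z /ltW hz.
  by rewrite -!psiE; exact: z0max.
have := hgrad _ (has_gradient_C1 Hpsi) z0 z0op lmax.
rewrite (has_gradient_grad_x _ Hpsi); have [y yE] : exists y, y = z0.1 - x1 by eexists.
rewrite -yE.
rewrite !dotDr !dotZr dot0r mulr0 addr0 -/d => E.
(* The slope of [psi] along [h] is [2 * kap * dot h y], and the assumption on gradients makes it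
   vanish. *)
have hy0 : dot h y = 0.
  have : 2 * kap * dot h y = 0.
    apply: (addIr (dot h pb)); rewrite add0r -[RHS]E /cc.
    by field; rewrite gt_eqF.
  by move/eqP; rewrite mulf_eq0 mulf_eq0 pnatr_eq0/= gt_eqF//= => /eqP.
have near_z1 : `|z0 - z1| < rho.
  rewrite ltNge; apply/negP => far.
  have s0 : K * `|z0 - z1| ^+ 2 <= C * (1 + `|z0 - z1|).
    apply: le_trans psiC; rewrite /psi -yE hy0 expr0n/= mulr0 addr0 -mulrDr.
    by rewrite yE ler_pM2l//; exact: sq_norm.
  pose s := `|z0 - z1|; rewrite -/s in s0 far.
  have s1 : 0 < s by exact: lt_le_trans far.
  have a1 : rho * s <= s ^+ 2 by rewrite expr2 ler_pM2r.
  have a2 : rho ^+ 2 <= s ^+ 2 by rewrite ler_pXn2r// nnegrE ltW.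
  have a3 : rho ^+ 2 * s <= rho * s.
    by rewrite ler_pM2r// expr2 ler_piMr// ltW.
  have a4 : rho ^+ 2 * (1 + s) <= 2 * s ^+ 2 by rewrite mulrDr mulr1; lra.
  have a5 : C * (rho ^+ 2 * (1 + s)) <= C * (2 * s ^+ 2) by rewrite ler_pM2l.
  have a6 : rho ^+ 2 * (K * s ^+ 2) <= rho ^+ 2 * (C * (1 + s)).
    by rewrite ler_pM2l// exprn_gt0.
  have a7 : 2 * C * s ^+ 2 < K * rho ^+ 2 * s ^+ 2 by rewrite ltr_pM2r// exprn_gt0.
  have a8 : rho ^+ 2 * (C * (1 + s)) = C * (rho ^+ 2 * (1 + s)) by ring.
  have a9 : rho ^+ 2 * (K * s ^+ 2) = K * rho ^+ 2 * s ^+ 2 by ring.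
  have a10 : C * (2 * s ^+ 2) = 2 * C * s ^+ 2 by ring.
  by move: a5 a6 a7; rewrite a8 a9 a10; lra.
(* Near the centre [v] has risen by at most [g / 2], but the maximum value is at least
   [v z1 + g - mu] with [mu = g / 4]. *)
have := vr z0 hz0 (lt_le_trans near_z1 rhor); have := z0max _ hzh; rewrite psi_h.
have : 0 <= psi z0.
  apply: le_trans (psi_ge z0).
  by apply: addr_ge0; apply: mulr_ge0; rewrite ?sqr_ge0// ltW.
by rewrite /mu; move: g0; rewrite /g; lra.
Qed.

End NullDirection.

(** * Lower bound for solutions *)

Section LowerBound.
Context {R : realType} {m n : nat}.
Variables (p : 'I_m.+1 -> 'rV[R]_n) (theta gamma : 'I_m.+1 -> R).
Local Notation T := ('rV[R]_n * R)%type.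
Local Notation neuron := (neuron p theta gamma).
Local Notation f := (f p theta gamma).
Local Notation H := (H p theta gamma).

(** All weights are positive, so the barycentre [pb] is in the relative interior of the hull of the
    [p i]. *)
Definition uniform_weights : 'rV[R]_m.+1 := \row_i m.+1%:R^-1.
Local Notation pb := (bary p uniform_weights).

Lemma uniform_simplex : simplex uniform_weights.
Proof.
apply/simplexP; split=> [i|]; first by rewrite mxE invr_ge0 ler0n.
rewrite cost1; under eq_bigr do rewrite mxE.
by rewrite sumr_const card_ord -[X in X = _]mulr_natr mulVf// pnatr_eq0.
Qed.

(** Turns upper bounds on all the [dot (p i - pb) x] into lower bounds. *)
Lemma sum_dot_centered x : \sum_i dot (p i - pb) x = 0.
Proof.
under eq_bigr do rewrite dotBl; rewrite sumrB sumr_const card_ord dot_bary /cost.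
under [X in _ - X *+ _ = _]eq_bigr do rewrite mxE.
by rewrite -mulr_sumr -[X in _ - X]mulr_natr mulrAC mulVf ?pnatr_eq0// mul1r subrr.
Qed.

Definition centered_mx : 'M[R]_(n, m.+1) := \matrix_(k, i) (p i - pb) 0 k.

Lemma mul_centered_mx (x : 'rV[R]_n) i : (x *m centered_mx) 0 i = dot (p i - pb) x.
Proof. by rewrite mxE; apply: eq_bigr => k _; rewrite [centered_mx k i]mxE mulrC. Qed.

(* [reduce x] differs from [x] by a vector on which all the [p i] agree, and is
   controlled by the numbers [dot (p i - pb) x] alone. *)
Definition reduce (x : 'rV[R]_n) : 'rV[R]_n := x *m centered_mx *m pinvmx centered_mx.

Lemma dot_sub_reduce x i : dot (p i) (x - reduce x) = dot pb (x - reduce x).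
Proof.
apply/eqP; rewrite -subr_eq0 -dotBl -mul_centered_mx mulmxBl.
by rewrite [reduce x *m _]mulmxKpV ?submxMl// subrr mxE.
Qed.

Lemma norm_reduce_le : exists2 K : R, 0 <= K & forall x c, 0 <= c ->
  (forall i, `|dot (p i - pb) x| <= c) -> `|reduce x| <= K * c.
Proof.
pose P := pinvmx centered_mx.
have s0 i : 0 <= \sum_k `|P k i| by exact: sumr_ge0.
exists (\sum_i \sum_k `|P k i|) => [|x c c0 xc]; first exact: sumr_ge0.
apply: norm_le_coord => [|i]; first by rewrite mulr_ge0 ?sumr_ge0.
rewrite mxE (le_trans (ler_norm_sum _ _ _))//.
apply: (@le_trans _ _ ((\sum_k `|P k i|) * c)).
  rewrite mulr_suml ler_sum// => k _.
  by rewrite normrM mul_centered_mx mulrC ler_wpM2l.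
by rewrite ler_wpM2r// (bigD1 i)//= lerDl sumr_ge0.
Qed.

Lemma H_finite_bary q : (H q < +oo)%E -> exists2 alpha, simplex alpha & bary p alpha = q.
Proof.
rewrite /Defs.H; case: ifPn => [/domJstarP[alpha /feasibleP[sa aq]] _|_]; last by rewrite ltxx.
by exists alpha.
Qed.

Variable w : T -> R.
Hypotheses (cw : {within closed_halfspace, continuous w})
  (w0 : forall x, w (x, 0) = J p gamma x)
  (ucw : uniformly_continuous_on closed_halfspace w)
  (subw : viscosity_subsolution H w).

(** A subsolution forces [H] to be finite at the gradient of a test function touching from above;
    this gradient is then in the hull, on which [dot h] is constant. *)
Lemma null_shift_le h x t : (forall i, dot (p i) h = dot pb h) -> 0 <= t ->
  w (x + h, t) <= w (x, t) + dot pb h.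
Proof.
move=> hN; rewrite le_eqVlt => /orP[/eqP <-|t0].
  rewrite !w0; apply/max_ord_le => i; rewrite dotDr hN addrAC lerD2r; exact: le_J.
rewrite (dotC pb); apply: null_direction_le => // phi cphi z hz lmax.
have [|alpha sa <-] := @H_finite_bary (grad_x phi z).
  have := subw cphi hz lmax; case: (H _) => [r _||//]; first exact: ltry.
  by rewrite addey.
rewrite (dotC h) dot_bary (dotC h) -(cost_const (dot pb h) sa).
by apply: eq_cost.
Qed.

Lemma null_shift h x t : (forall i, dot (p i) h = dot pb h) -> 0 <= t ->
  w (x + h, t) = w (x, t) + dot pb h.
Proof.
move=> hN t0; apply/eqP; rewrite eq_le null_shift_le//= -lerBrDr -dotNr.
rewrite -{1}(addrK h x); apply: null_shift_le => // i; by rewrite !dotNr hN.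
Qed.

(** Only time is penalized, so the spatial gradient of the test function stays at [bary p alpha]. A
    minimum still exists, since the relative interior position gives coercivity modulo the
    directions removed by [reduce]. *)
Lemma relint_lower i (l : R) alpha : viscosity_supersolution H w ->
  0 < l <= 1 -> minimizers p gamma (bary p alpha) alpha ->
  bary p alpha = (1 - l) *: p i + l *: pb ->
  forall z, closed_halfspace z -> cost (fun j => neuron j z.1 z.2) alpha <= w z.
Proof.
move=> supw /andP[l0 l1] amin aq z1 hz1; have [[sa _] _] := amin.
rewrite leNgt; apply/negP => lt; have t10 : 0 <= z1.2 := hz1.
pose L (z : T) := dot (bary p alpha) z.1 + - cost theta alpha * z.2 + - cost gamma alpha.
have LE z : cost (fun j => neuron j z.1 z.2) alpha = L z.
  by rewrite cost_neuron// /L; ring.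
have HL : has_gradient L _ _ := has_gradient_affine _ _ _.
have Lf z : L z <= f z.
  rewrite -LE -(cost_const (f z) sa) le_cost// => j _; case: z => x t; exact: le_f.
pose a := (L z1 - w z1) / 2.
have a0 : 0 < a by rewrite divr_gt0// subr_gt0 -LE.
have aE : L z1 - w z1 = 2 * a by rewrite mulrC divfK.
pose eta := a / (1 + z1.2 + z1.2 ^+ 2).
have d1 : 0 < 1 + z1.2 + z1.2 ^+ 2 by rewrite -addrA ltr_pwDl// addr_ge0// exprn_ge0.
have eta0 : 0 < eta by exact: divr_gt0.
have etaa : eta * (z1.2 + z1.2 ^+ 2) <= a.
  have : eta * (1 + z1.2 + z1.2 ^+ 2) = a by rewrite divfK// gt_eqF.
  by rewrite !mulrDr; move: eta0; lra.
have [C C0 wfC] := solution_growth theta w0 ucw.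
pose u z := - (w z - (L z - penalty 0 eta z)).
have Hphi := has_gradientD HL (has_gradientZ (-1) (has_gradient_penalty 0 eta)).
have uz1 : 0 < u z1.
  by rewrite /u /penalty mul0r add0r; move: etaa aE a0; lra.
pose B := 1 + 2 * C / eta.
have B0 : 0 <= B.
  by apply: addr_ge0 => //; apply: divr_ge0; [exact: mulr_ge0|exact: ltW].
pose S := \sum_j `|theta j|; pose G := \sum_j `|gamma j|.
have abs_le (b : 'I_m.+1 -> R) j : `|b j| <= \sum_j `|b j|.
  by rewrite (bigD1 j)//= lerDl sumr_ge0.
have cost_ge (b : 'I_m.+1 -> R) j : b j - cost b alpha <= 2 * \sum_j `|b j|.
  have : - \sum_j `|b j| <= cost b alpha.
    rewrite -(cost_const (- \sum_j `|b j|) sa) le_cost// => k _.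
    by rewrite lerNl (le_trans (ler_norm _))// normrN.
  have := abs_le b j; rewrite ler_norml => /andP[_ +]; lra.
have S0 : 0 <= S by exact: sumr_ge0.
have G0 : 0 <= G by exact: sumr_ge0.
pose E := C * (1 + B) + 2 * B * S + 2 * G.
have E0 : 0 <= E.
  by apply: addr_ge0; [apply: addr_ge0|]; do ?[apply: mulr_ge0 => //|exact: addr_ge0].
pose E' := E + E / l; have El0 : 0 <= E / l by rewrite divr_ge0// ltW.
have E'0 : 0 <= E' by exact: addr_ge0.
have [K K0 redK] := norm_reduce_le.
have u_reduce x t : 0 <= t -> u (x, t) = u (reduce x, t).
  move=> t0; have hN := dot_sub_reduce x.
  have -> : u (x, t) = - (w (reduce x + (x - reduce x), t) -
      (L (reduce x + (x - reduce x), t) - penalty 0 eta (x, t))).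
    by rewrite [reduce x + _]addrC subrK.
  have qN : dot (bary p alpha) (x - reduce x) = dot pb (x - reduce x).
    by rewrite aq dotDl !dotZl hN; ring.
  by rewrite null_shift// /u /L /penalty/= !mul0r (dotDr _ (reduce x)) qN; ring.
have bound z : closed_halfspace z -> 0 < u z ->
    z.2 <= B /\ forall k, `|dot (p k - pb) z.1| <= m.+1%:R * E'.
  case: z => x t /= t0; rewrite /u /penalty/= mul0r add0r => uz.
  have := wfC (x, t) t0; rewrite ler_norml/= => /andP[wf _].
  have tB : t <= B.
    have et : 0 <= eta * t by exact: mulr_ge0 (ltW eta0) t0.
    apply: sqr_le_affine => //; have := Lf (x, t).
    by move: uz wf et; lra.
  split=> //.
  have et0 : 0 <= eta * (t + t ^+ 2) by rewrite mulr_ge0 ?addr_ge0 ?exprn_ge0// ltW.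
  have CB : C * (1 + t) <= C * (1 + B) by rewrite ler_wpM2l// lerD2l.
  (* Where [w] is below [L], neuron [k] exceeds [L] by at most [C * (1 + B)]; the rest of [E]
     absorbs the differences in [theta] and [gamma]. *)
  have up0 k : dot (p k - bary p alpha) x <= E.
    have := le_f p theta gamma k x t; rewrite dotBl /neuron.
    have th := ler_wpM2l t0 (cost_ge theta k); rewrite mulrBr in th.
    have BS : t * (2 * S) <= 2 * B * S.
      by rewrite mulrCA -mulrA ler_wpM2l// ler_wpM2r.
    have := cost_ge gamma k; rewrite -/G => ga.
    move: uz wf th BS; rewrite -/S /L/= /E; lra.
  (* [p i - bary p alpha] is [l] times [p i - pb], hence the division by [l]. *)
  have upi : dot (p i - pb) x <= E / l.
    rewrite ler_pdivlMr// mulrC; apply: le_trans (up0 i).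
    by rewrite aq !dotBl dotDl !dotZl; lra.
  have up k : dot (p k - pb) x <= E'.
    have := up0 k; rewrite aq !dotBl dotDl !dotZl /E' => le1.
    have le2 : (1 - l) * dot (p i - pb) x <= E / l.
      have [pos|neg] := leP 0 (dot (p i - pb) x).
        by apply: le_trans upi; rewrite ler_piMl// gerBl ltW.
      by rewrite (@le_trans _ _ 0)// mulr_ge0_le0 ?subr_ge0// ltW.
    by move: le1 le2; rewrite dotBl; lra.
  move=> k; rewrite ler_norml; apply/andP; split.
    have := sum_dot_centered x; rewrite (bigD1 k)//= => sum0.
    have : \sum_(j | j != k) dot (p j - pb) x <= \sum_(j | j != k) E' by exact: ler_sum.
    have : \sum_(j | j != k) E' <= \sum_(j < m.+1) E'.
      by rewrite [leRHS](bigD1 k)//= lerDr.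
    have -> : \sum_(j < m.+1) E' = m.+1%:R * E' by rewrite sumr_const card_ord mulr_natl.
    by move: sum0; lra.
  by apply: (le_trans (up k)); rewrite ler_peMl// ler1n.
have [||z0 hz0 z0max] := @coercive_max _ _ u z1 (K * (m.+1%:R * E') + B) _ hz1.
- have cphi : continuous (fun z => L z - penalty 0 eta z).
    rewrite (_ : (fun z => _) = fun z => L z + -1 * penalty 0 eta z).
      exact: has_gradient_continuous Hphi.
    by apply/funext => z; rewrite mulN1r.
  have cu := continuous_withinB cw cphi.
  by move=> z; apply: (@cvgN R^o); exact: cu.
- move=> z hz uz; have [zB zk] := bound z hz (lt_le_trans uz1 uz).
  exists (reduce z.1, z.2); last by rewrite -u_reduce// -surjective_pairing.
  split=> //; have mE0 : 0 <= m.+1%:R * E' by rewrite mulr_ge0.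
  rewrite prod_normE/= ge_max; apply/andP; split.
    by apply: (le_trans (redK _ _ mE0 zk)); rewrite lerDl.
  by rewrite ger0_norm// (le_trans zB)// lerDr mulr_ge0.
have uz0 : 0 < u z0 by exact: lt_le_trans (z0max _ hz1).
have z0op : open_halfspace z0.
  rewrite /open_halfspace/= lt_neqAle; apply/andP; split=> //; apply/eqP => t0.
  move: uz0 (Lf z0); rewrite /u /penalty mul0r add0r.
  case: z0 t0 {hz0 z0max} => x t /= <-; rewrite f0 w0 expr0n addr0 mulr0; lra.
have lmin : local_min (fun z => w z - (L z + -1 * penalty 0 eta z)) z0.
  have := near_open_halfspace z0op; apply: filterS => z /ltW hz.
  by have := z0max z hz; rewrite /u; lra.
have := supw _ (has_gradient_C1 Hphi) z0 z0op lmin.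
rewrite (has_gradient_dt _ Hphi) (has_gradient_grad_x _ Hphi).
rewrite mulr0 scale0r scaler0 addr0.
have := H_le theta amin; case: (H _) => [r||]; [|by rewrite leye_eq|by rewrite addeNy].
by rewrite -EFinD !lee_fin; have := mulr_gt0 eta0 z0op; lra.
Qed.

End LowerBound.

(** * Almost active weights *)

Section Hamiltonians.
Context {R : realType} {m n : nat}.
Variables (p : 'I_m.+1 -> 'rV[R]_n) (theta gamma : 'I_m.+1 -> R).
Local Notation T := ('rV[R]_n * R)%type.
Local Notation neuron := (neuron p theta gamma).
Local Notation f := (f p theta gamma).
Local Notation H := (H p theta gamma).

(** [active_le] is used at [bary p alpha + r]: the term in [x] has the right sign, and the
    difference of [gamma]-costs is at most [dot r y] for a dual point [y] of a finite family. Half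
    of [e * tau] goes to [kappa], half to [dot r y]. *)
Lemma almost_active_le_H (e tau : R) : 0 < e -> 0 < tau -> exists2 kappa : R, 0 < kappa &
  exists2 delta : R, 0 < delta & forall x t (alpha : 'rV[R]_m.+1) r,
  tau <= t -> simplex alpha ->
  f (x, t) - kappa <= cost (fun i => neuron i x t) alpha ->
  `|r| <= delta -> 0 <= dot r x ->
  ((cost theta alpha - e)%:E <= H (bary p alpha + r))%E.
Proof.
move=> e0 tau0; have [Y hY] := dual_family p gamma.
pose D := n%:R * \sum_S `|Y S|.
have D0 : 0 <= D by rewrite mulr_ge0// sumr_ge0.
have D1 : 0 < D + 1 by exact: ltr_wpDl.
have et : 0 < e * tau / 2 by rewrite divr_gt0// mulr_gt0.
exists (e * tau / 2) => //; exists (e * tau / 2 / (D + 1)); first exact: divr_gt0.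
move=> x t alpha r taut sa act; rewrite ler_pdivlMr// => rD rx.
apply: H_ge => beta bmin; have [[sb bq] _] := bmin.
have act_le := active_le sa act bmin.
move: act_le; rewrite opprD addNKr dotNl => act_le.
set y := Y [set j | 0 < beta 0 j]%SET; have yact := hY _ _ bmin; rewrite -/y in yact.
have gb : cost gamma beta = dot (bary p alpha + r) y - J p gamma y.
  rewrite -bq -/(bary p beta) dot_bary -[X in _ - X](cost_const _ sb) -mulN1r -costDw.
  by apply: eq_cost => // j /yact <-; ring.
have ga : dot (bary p alpha) y - J p gamma y <= cost gamma alpha.
  rewrite dot_bary -[X in _ - X](cost_const _ sa) -mulN1r -costDw.
  by apply: le_cost => // j _; rewrite mulN1r lerBlDl -lerBlDr; exact: le_J.
have ry : dot r y <= e * tau / 2.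
  apply: le_trans rD; apply: le_trans (ler_norm _) _; apply: le_trans (norm_dot_le _ _) _.
  rewrite mulrAC mulrC ler_wpM2l//; apply: (@le_trans _ _ D); last by rewrite lerDl.
  by rewrite ler_wpM2l// (bigD1 [set j | 0 < beta 0 j]%SET)//= lerDl sumr_ge0.
have le : t * (cost theta alpha - cost theta beta) <= e * tau.
  by move: act_le gb ga ry rx; rewrite dotDl; lra.
rewrite lerBlDr -lerBlDl leNgt; apply/negP => lt.
have : e * tau < t * (cost theta alpha - cost theta beta).
  rewrite mulrC; apply: (@le_lt_trans _ _ (t * e)); first by rewrite ler_wpM2r// ltW.
  by rewrite ltr_pM2l// (lt_le_trans tau0).
by rewrite ltNge le.
Qed.

Lemma continuous_bary : continuous (bary p).
Proof.
rewrite (_ : bary p = \sum_i (fun alpha : 'rV[R]_m.+1 => alpha 0 i *: p i)); last first.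
  by apply/funext => alpha; rewrite fct_sumE.
apply: (big_ind (fun g : 'rV[R]_m.+1 -> 'rV[R]_n => continuous g)) => [x|g h cg ch x|i _ x].
- exact: (@cst_continuous _ _ (0 : 'rV[R]_n) x).
- exact: cvgD (cg x) (ch x).
- have ci : continuous (fun alpha : 'rV[R]_m.+1 => alpha 0 i) := @coord_continuous R 1 m.+1 0 i.
  exact: (cvgZr_tmp (ci x)).
Qed.

(** The previous estimate at [r = 0] is combined with continuity of [Ham], uniform over the compact
    simplex of weights; each takes [e / 2]. *)
Lemma almost_active_le_continuous (Ham : 'rV[R]_n -> R) (e tau : R) : continuous Ham ->
  (forall q, q \in domJstar p gamma -> (H q <= (Ham q)%:E)%E) ->
  0 < e -> 0 < tau -> exists2 kappa : R, 0 < kappa &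
  exists2 delta : R, 0 < delta & forall x t (alpha : 'rV[R]_m.+1) r,
  tau <= t -> simplex alpha ->
  f (x, t) - kappa <= cost (fun i => neuron i x t) alpha ->
  `|r| <= delta -> 0 <= dot r x ->
  ((cost theta alpha - e)%:E <= (EFin \o Ham) (bary p alpha + r)%R)%E.
Proof.
move=> cHam hHam e0 tau0; have e2 : 0 < e / 2 by exact: divr_gt0.
have [kappa k0 [delta0 d0 hk]] := almost_active_le_H e2 tau0.
have /compact_near_coveringP/(_ _ (nbhs (0 : 'rV[R]_n))
    (fun r alpha => `|Ham (bary p alpha) - Ham (bary p alpha + r)| < e / 2)) :=
  @simplex_compact R m.
move=> /(_ (nbhs_filter _)) unif.
have : \forall r \near (0 : 'rV[R]_n), @simplex R m.+1 `<=`
    (fun alpha => `|Ham (bary p alpha) - Ham (bary p alpha + r)| < e / 2).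
  apply: unif => alpha _.
  have c1 : Ham (bary p z.1) - Ham (bary p z.1 + z.2) 
      @[z --> (alpha, (0 : 'rV[R]_n))] --> (0 : R).
    rewrite -[X in _ --> X](subrr (Ham (bary p alpha))).
    have cb : bary p z.1 @[z --> (alpha, (0 : 'rV[R]_n))] --> bary p alpha.
      by apply: (@cvg_comp _ _ _ fst (bary p)); [exact: cvg_fst|exact: continuous_bary].
    apply: (@cvgB R R^o); first by apply: cvg_comp cb _; exact: cHam.
    have c2 : bary p z.1 + z.2 @[z --> (alpha, (0 : 'rV[R]_n))] --> bary p alpha + 0.
      by apply: cvgD; [exact: cb|exact: cvg_snd].
    by rewrite addr0 in c2; apply: cvg_comp c2 _; exact: cHam.
  by have := cvgr0_norm_lt _ c1 _ e2; apply; exact: nbhs_filter.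
move=> /nbhs_norm0P[d /= dpos hd].
exists kappa => //; exists (d / 2) => [|x t alpha r taut sa act rd _]; first exact: divr_gt0.
have dr : d > `|r| by apply: le_lt_trans rd _; rewrite ltr_pdivrMr// ltr_pMr// ltr1n.
have /= close := hd r dr alpha sa.
have := hk x t alpha 0 taut sa act; rewrite normr0 dot0l addr0 => /(_ (ltW d0) (lexx _)) le.
have qD : bary p alpha \in domJstar p gamma by apply/domJstarP; exists alpha.
have := le_trans le (hHam _ qD); rewrite !lee_fin.
by move: close => /ltW; rewrite ler_norml => /andP[_]; lra.
Qed.

Hypotheses (hA2 : assumptionA2 p gamma) (hA3 : assumptionA3 p theta gamma).

(** The weights [(1 - s) *: delta_mx 0 i + s *: beta] satisfy [relint_lower] for every small [s > 0]
    and tend to the Dirac weight at [i]. *)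
Lemma lower_bound_H w : {within closed_halfspace, continuous w} ->
  (forall x, w (x, 0) = J p gamma x) -> uniformly_continuous_on closed_halfspace w ->
  viscosity_subsolution H w -> viscosity_supersolution H w ->
  forall z, closed_halfspace z -> f z <= w z.
Proof.
move=> cw w0 ucw subw supw z hz; have [i ->] := f_activeP p theta gamma z.
have [l /andP[l0 l1] [beta bE [sb bmin]]] :=
  radial_minimizers hA2 i uniform_simplex.
rewrite leNgt; apply/negP => lt.
pose g := neuron i z.1 z.2 - w z; have g0 : 0 < g by rewrite subr_gt0.
pose D := cost (fun j => neuron j z.1 z.2) beta - neuron i z.1 z.2.
have D1 : 0 < `|D| + 1 + g by rewrite addr_gt0// ltr_wpDl.
(* With this [s] the error [s * D] made in replacing neuron [i] by the average is smaller in
   absolute value than the gap [g]. *)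
pose s := g / (`|D| + 1 + g); have s0 : 0 < s by exact: divr_gt0.
have s1 : s <= 1 by rewrite ler_pdivrMr// mul1r lerDr addr_ge0.
have s01 : 0 <= s <= 1 by rewrite ltW.
have sl : 0 < s * l <= 1.
  by rewrite mulr_gt0//= (le_trans _ s1)// ler_piMr// ltW.
have aE : bary p ((1 - s) *: delta_mx 0 i + s *: beta) =
    (1 - s * l) *: p i + (s * l) *: bary p uniform_weights.
  rewrite baryD !baryZ bary_delta bE scalerDr !scalerA addrA -scalerDl.
  by congr (_ *: _ + _); ring.
have := relint_lower cw w0 ucw subw supw sl (bmin s s01) aE hz.
rewrite costD !costZ cost_delta leNgt => /negP; apply.
have sE : s * (`|D| + 1 + g) = g by rewrite divfK// gt_eqF.
have := ler_wpM2l (ltW s0) (ler_norm (- D)); rewrite normrN.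
have sg : 0 < s * g by exact: mulr_gt0.
have -> : cost (fun j => neuron j z.1 z.2) beta = neuron i z.1 z.2 + D by rewrite /D; ring.
have -> : neuron i z.1 z.2 = w z + g by rewrite /g; ring.
by move: sE sg s0; clearbody D g s; rewrite !mulrDr mulr1; lra.
Qed.

End Hamiltonians.

(** * Uniqueness and the converse *)

Section Solutions.
Context {R : realType} {m n : nat}.
Variables (p : 'I_m.+1 -> 'rV[R]_n) (theta gamma : 'I_m.+1 -> R).
Local Notation T := ('rV[R]_n * R)%type.
Local Notation neuron := (neuron p theta gamma).
Local Notation f := (f p theta gamma).
Local Notation J := (J p gamma).
Local Notation H := (H p theta gamma).
Hypotheses (hA2 : assumptionA2 p gamma) (hA3 : assumptionA3 p theta gamma).

Lemma f_viscosity_solution (Ham : 'rV[R]_n -> \bar R) :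
  (forall i, Ham (p i) = H (p i)) ->
  (forall q, q \in domJstar p gamma -> (H q <= Ham q)%E) ->
  viscosity_solution Ham J f.
Proof.
move=> hv hd; split.
- by apply: continuous_subspaceT; exact: f_continuous.
- exact: f0.
- by apply: f_subsolution => i; rewrite hv H_vertex.
- exact: f_supersolution.
Qed.

Lemma unique_solution_H : unique_UC_viscosity_solution H J f.
Proof.
split; [exact: f_viscosity_solution|exact: f_uniformly_continuous|].
move=> w [cw w0 subw supw] ucw z; rewrite inE => hz; apply/eqP; rewrite eq_le.
apply/andP; split; last exact: (lower_bound_H hA2 cw w0 ucw subw supw hz).
apply: (comparison_upper cw w0 ucw subw _ hz) => e tau e0 tau0.
exact: almost_active_le_H.
Qed.

Lemma unique_solution_continuous (Ham : 'rV[R]_n -> R) : continuous Ham ->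
  (forall i, (Ham (p i))%:E = H (p i)) ->
  (forall q, q \in domJstar p gamma -> (H q <= (Ham q)%:E)%E) ->
  unique_UC_viscosity_solution (EFin \o Ham) J f.
Proof.
move=> cHam hv hd.
split; [exact: f_viscosity_solution|exact: f_uniformly_continuous|].
move=> w [cw w0 subw supw] ucw z; rewrite inE => hz; apply/eqP; rewrite eq_le.
apply/andP; split.
  apply: (comparison_upper cw w0 ucw subw _ hz) => e tau e0 tau0.
  exact: almost_active_le_continuous.
apply: (comparison_lower cw w0 ucw supw _ hz) => i e e0.
have HamE : Ham (p i) = theta i by apply: EFin_inj; rewrite hv H_vertex.
have : \forall q \near p i, `|Ham (p i) - Ham q| < e.
  by apply: (@cvgr_dist_lt _ _ _ (nbhs (p i)) _ Ham (Ham (p i))) e0; exact: cHam.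
move=> /nbhs_normP[d /= d0 hd']; exists (d / 2) => [|r rd]; first exact: divr_gt0.
rewrite /= lee_fin; have : `|Ham (p i) - Ham (p i + r)| < e.
  apply: hd'; rewrite /ball_/= opprD addNKr normrN.
  by apply: le_lt_trans rd _; rewrite ltr_pdivrMr// ltr_pMr// ltr1n.
by rewrite HamE => /ltW; rewrite ler_norml => /andP[+ _]; lra.
Qed.

Lemma solution_ge_H (Ham : 'rV[R]_n -> R) q : viscosity_supersolution (EFin \o Ham) f ->
  q \in domJstar p gamma -> (H q <= (Ham q)%:E)%E.
Proof.
move=> sup /(H_lexi theta)[alpha [amin alex ->]]; have [[sa aq] _] := amin.
have [//|x [t [t0 _ act _]]] := @lexi_certificate _ _ _ _ theta _ _ _ pred0 amin alex.
have Hphi := has_gradient_affine (bary p alpha) (- cost theta alpha) (- cost gamma alpha).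
have phiE z : dot (bary p alpha) z.1 + - cost theta alpha * z.2 + - cost gamma alpha =
    cost (fun i => neuron i z.1 z.2) alpha by rewrite cost_neuron//; ring.
have := sup _ (has_gradient_C1 Hphi) (x, t) t0.
rewrite (has_gradient_dt _ Hphi) (has_gradient_grad_x _ Hphi) /= -EFinD lee_fin.
rewrite -[q]aq lee_fin addrC subr_ge0; apply.
apply: (@filterE _ (nbhs ((x, t) : T)) (nbhs_filter _)) => z; rewrite !phiE.
rewrite (_ : cost _ alpha = f (x, t)).
  rewrite subrr subr_ge0 -(cost_const (f z) sa) le_cost// => i _.
  by case: z => y s; exact: le_f.
by rewrite -[RHS](cost_const _ sa); exact: eq_cost.
Qed.

Lemma continuous_neuron i : continuous (fun z : T => neuron i z.1 z.2).
Proof.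
rewrite (_ : (fun z => _) = fun z : T => dot (p i) z.1 + - theta i * z.2 + - gamma i).
  exact: (has_gradient_continuous (has_gradient_affine _ _ _)).
by apply/funext => z; rewrite /neuron; ring.
Qed.

Lemma near_strictly_active i z0 :
  (forall j, j != i -> neuron j z0.1 z0.2 < neuron i z0.1 z0.2) ->
  \forall z \near z0, f z = neuron i z.1 z.2.
Proof.
move=> strict.
have : \forall z \near z0, forall j, j != i -> neuron j z.1 z.2 <= neuron i z.1 z.2.
  apply: (@filter_forall _ _ _ _ (nbhs_filter z0)) => j.
  have [->|ji] := eqVneq j i; first exact: (@filterE _ _ (nbhs_filter z0)).
  have cij : continuous (fun z : T => neuron i z.1 z.2 - neuron j z.1 z.2).
    by move=> z; apply: (@cvgB R R^o); exact: continuous_neuron.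
  have : 0 < neuron i z0.1 z0.2 - neuron j z0.1 z0.2 by rewrite subr_gt0 strict.
  move=> /(cvgr_gt _ (cij z0)); apply: filterS => z /ltW h _.
  by rewrite -subr_ge0.
apply: filterS => z le; apply/eqP; rewrite eq_le; apply/andP; split.
  by have [j ->] := f_activeP p theta gamma z; have [->//|/le] := eqVneq j i.
by case: z le => *; exact: le_f.
Qed.

(** Around a strictly active point [f] coincides with neuron [i], which is then itself a test
    function. *)
Lemma solution_le_vertex (Ham : 'rV[R]_n -> R) i : viscosity_subsolution (EFin \o Ham) f ->
  Ham (p i) <= theta i.
Proof.
move=> sub; have [x [t [t0 strict]]] := strictly_active_point hA2 hA3 i.
have Hi := has_gradient_affine (p i) (- theta i) (- gamma i).
have phiE z : dot (p i) z.1 + - theta i * z.2 + - gamma i = neuron i z.1 z.2.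
  by rewrite /neuron; ring.
have near_eq := @near_strictly_active i (x, t) strict.
have := sub _ (has_gradient_C1 Hi) (x, t) t0.
rewrite (has_gradient_dt _ Hi) (has_gradient_grad_x _ Hi) /= -EFinD lee_fin.
rewrite addrC subr_le0; apply; have fxt := nbhs_singleton near_eq.
by apply: filterS near_eq => z fz; rewrite !phiE fz fxt !subrr.
Qed.

End Solutions.

Theorem theorem3p1 (R : realType) (m n : nat)
    (p : 'I_m.+1 -> 'rV[R]_n.+1) (theta gamma : 'I_m.+1 -> R)
    (hA1 : assumptionA1 p) (hA2 : assumptionA2 p gamma)
    (hA3 : assumptionA3 p theta gamma)
    (Htilde : 'rV[R]_n.+1 -> R) (hHtilde : continuous Htilde) :
  (unique_UC_viscosity_solution (H p theta gamma) (J p gamma)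
      (f p theta gamma) /\
    convex_function (closed_halfspace (R := R) (n := n.+1)) (f p theta gamma))
  /\
  (unique_UC_viscosity_solution (EFin \o Htilde) (J p gamma)
      (f p theta gamma) <->
    (forall i, (Htilde (p i))%:E = H p theta gamma (p i)) /\
    (forall q, q \in domJstar p gamma ->
      (H p theta gamma q <= (Htilde q)%:E)%E)).
Proof.
split; first by split; [exact: unique_solution_H|exact: f_convex].
split=> [[[_ _ sub sup] _ _]|[hv hd]]; last exact: unique_solution_continuous.
have ge q : q \in domJstar p gamma -> (H p theta gamma q <= (Htilde q)%:E)%E.
  exact: solution_ge_H.
split=> // i; apply/eqP; rewrite eq_le; apply/andP; split.
  by rewrite H_vertex// lee_fin; exact: (solution_le_vertex hA2 hA3).
apply: ge; apply/domJstarP; exists (delta_mx 0 i); exact: (delta_minimizers hA2 i).1.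
Qed.
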